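(* Let $f$ be a $C^2$ function on $[\log 2,\infty)$ with $f(\log 2)<1$ satisfying: (i) $f>0$, $f'<0$, $f''>0$; (ii) $\lim_{n\to\infty}f(n)=0$; (iii) for every $\varepsilon>0$, $\lim_{N\to\infty}N^{\varepsilon}(-f'(\log N))^{1/2}=\infty$; (iv) $\lim_{\varepsilon\downarrow0}\Bigl(\limsup_{k\to\infty}\frac{-f'((1-\varepsilon)k)}{-f'(k)}\Bigr)=1$. Let $d\mu(x)=w(x)\,dx$ be the measure with Jacobi parameters $b_n\equiv0$, $a_n=1-f(\log(n+1))$ ($n\ge1$), and write $w(x)=e^{-2Q(x)}$ on $(-2,2)$. For $x<2$ near $2$ let $$N(x)=\bigl[\exp\bigl(f^{-1}(1-\tfrac x2)\bigr)\bigr]-1,$$ where $[y]$ is the largest integer $\le y$. Then, as $x\uparrow2$, $$|Q(x)-g(x)|\le h(x),$$ where $$g(x)=\sqrt{\tfrac{\pi}{2}}\;N(x)\,\bigl(-f'(\log N(x))\bigr)^{1/2}(1+o(1)),\qquad h(x)=O(\log N(x))+O\bigl(|\log(1-\tfrac x2)|\bigr).$$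
   Context: For bounded Jacobi parameters $\{a_n,b_n\}_{n\ge1}$ ($a_n>0$, $b_n\in\mathbb{R}$), the associated measure is the unique compactly supported probability measure $\mu$ on $\mathbb{R}$ whose orthonormal polynomials $p_n$ satisfy $xp_n=a_{n+1}p_{n+1}+b_{n+1}p_n+a_np_{n-1}$, $p_{-1}=0$, $p_0=1$. The function $g$ is the sum $g(x)=\sum_{j=1}^{N(x)}\gamma_j(x)$, where $\gamma_j(x)\ge0$ is defined by $x/a_j=2\cosh(\gamma_j(x))$ for $1\le j\le N(x)$; $N(x)$ is the largest $n$ with $2a_n\le x$. *)

(* Defs.v *)
From HB Require Import structures.
From mathcomp Require Import all_boot all_order all_algebra.
From mathcomp Require Import all_classical all_reals all_analysis.
Set Implicit Arguments.
Unset Strict Implicit.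
Unset Printing Implicit Defensive.
Import Order.TTheory GRing.Theory Num.Theory.
Import numFieldNormedType.Exports.
Local Open Scope classical_set_scope.
Local Open Scope ring_scope.

(* Derivatives relative to a domain D: the difference quotient at x only sees
   points of D, so that at an endpoint of an interval this is the one-sided
   derivative, and the values of f outside D are irrelevant. *)
Definition diff_quotient_within (R : realType) (D : set R) (f : R -> R) (x : R)
  : set_system R :=
  ((f y - f x) / (y - x)) @[y --> within D x^'].

Definition derivable_within (R : realType) (D : set R) (f : R -> R) (x : R)
  : Prop :=
  cvg (diff_quotient_within D f x).

Definition derive_within (R : realType) (D : set R) (f : R -> R) (x : R) : R :=
  lim (diff_quotient_within D f x).

Definition C2_on (R : realType) (D : set R) (f : R -> R) : Prop :=
  [/\ forall x, D x -> derivable_within D f x,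
      forall x, D x -> derivable_within D (derive_within D f) x
    & {within D, continuous (derive_within D (derive_within D f))}].

Definition log2_ray (R : realType) : set R := `[ln 2, +oo[.
Arguments log2_ray R : clear implicits.

Definition compactly_supported (R : realType)
  (mu : probability (measurableTypeR R) R) : Prop :=
  exists K : set R, compact K /\ mu (~` K) = 0%E.

Definition orthonormal_polys (R : realType)
  (mu : probability (measurableTypeR R) R) (p : nat -> {poly R}) : Prop :=
  [/\ forall n, size (p n) = n.+1,
      forall n, 0 < lead_coef (p n)
    & forall m n,
        (\int[mu]_x ((p m).[x] * (p n).[x])%:E = ((m == n)%:R)%:E)%E].

(* Jacobi parameters are indexed from 1: a 0 and b 0 are never used, the term
   a_0 p_{-1} of the recurrence being 0 because p_{-1} = 0. *)
Definition has_jacobi_parameters (R : realType)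
  (mu : probability (measurableTypeR R) R) (a b : nat -> R) : Prop :=
  compactly_supported mu /\
  exists p : nat -> {poly R},
    [/\ orthonormal_polys mu p,
        p 0%N = 1
      & forall n, 'X * p n = a n.+1 *: p n.+1 + b n.+1 *: p n
                  + (if n is m.+1 then a n *: p m else 0)].

Definition is_density (R : realType)
  (mu : probability (measurableTypeR R) R) (w : R -> R) : Prop :=
  [/\ measurable_fun [set: R] w,
      forall x, 0 <= w x
    & forall A : set R, measurable A ->
        (mu A = \int[lebesgue_measure]_(x in A) (w x)%:E)%E].

Definition a_ (R : realType) (f : R -> R) (n : nat) : R :=
  1 - f (ln n.+1%:R).

Definition cosh (R : realType) (t : R) : R := (expR t + expR (- t)) / 2.

Definition gamma_ (R : realType) (a : nat -> R) (j : nat) (x : R) : R :=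
  get [set t : R | 0 <= t /\ x / a j = 2 * cosh t].

(* The integer part is taken with Num.truncn, which agrees with the floor on
   nonnegative reals, and expR is positive. For f decreasing this is the
   largest n with 2 a_n <= x, since 2 a_n <= x iff 1 - x / 2 <= f (ln (n + 1)). *)
Definition N_ (R : realType) (f : R -> R) (x : R) : nat :=
  (Num.truncn (expR (pinv (log2_ray R) f (1 - x / 2)))).-1.

Definition g_ (R : realType) (f : R -> R) (x : R) : R :=
  \sum_(1 <= j < (N_ f x).+1) gamma_ (a_ f) j x.

(* Main.v *)
(* The idea is due to Dombrowski and Nevai. For a solution p_n(x) of the Jacobi
   recursion with b = 0, the quadratic form
     D_n(x) = a_{n+1}^2 (p_{n+1}^2 + p_n^2) - x a_{n+1} p_n p_{n+1}
   equals a_1^2 + sum_{k <= n} (a_{k+1}^2 - a_k^2) p_k^2, hence increases to a limit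
   D(x), finite and continuous on (-2, 2). Since a_n -> 1, the integrals of
   U_k D_n against mu converge to those of U_k against the semicircle law; as the
   D_n are monotone, D dmu is a compactly supported measure with the moments of
   the semicircle law, so w(x) = sqrt (4 - x^2) / (2 pi D(x)).

   For j <= N(x) the recursion is hyperbolic. The ratios p_j / p_{j-1} are at least
   exp (gamma_j), and, because the small characteristic root increases with j, the
   component of the solution along the large root grows at most by exp (gamma_j);
   hence exp (g) <= p_N <= C N exp (g). Beyond N(x), D_n / (a_{n+1}^2 - x^2 / 4)
   decreases. So ln D = 2 g + O(log N), the factors a_{N+1} - a_N being at least
   (N + 2)^(-2) by convexity of f and (iii).

   Finally gamma_j is close to sqrt (2 (f (log (j + 1)) - f (log M))), where
   x = 2 (1 - f (log M)), which by (iii), (iv) may be replaced by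
   sqrt (- 2 f' (log M) log (M / j)), and sum_{j <= M} sqrt (log (M / j)) is
   asymptotic to M times the integral of exp (- t^2) over [0, oo). *)
Require Import Defs.
From HB Require Import structures.
From mathcomp Require Import all_boot all_order all_algebra.
From mathcomp Require Import all_classical all_reals all_analysis.
From mathcomp Require Import measurable_realfun gauss_integral.
From mathcomp Require Import ring lra zify.
Import Order.TTheory GRing.Theory Num.Theory.
Import numFieldNormedType.Exports.
Local Open Scope classical_set_scope.
Local Open Scope ring_scope.

(** The two parts of h have separate origins. Up to a constant, 2 Q is [ln D] minus half of ln (4 -
    x^2): comparing [ln D] with 2 g loses only powers of N, hence O(log N), while 4 - x^2 = (1 -
    x/2) (4 + 2 x) accounts for |log (1 - x/2)|. A density is determined only up to null sets, so a
    pointwise statement about Q needs the continuous representative; this is why the forms D_n are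
    shown to converge locally uniformly on (-2, 2). The delicate index is the passage out of the
    hyperbolic region: a_{N+1}^2 - x^2/4 is positive but can be arbitrarily small. The upper bound
    for D is therefore read off from D_{N+1}, one step later, where the gap is at least a_{N+2}^2 -
    a_{N+1}^2. The limit at 2 is studied in the variable t with x = 2 (1 - f t), so that N + 1 is
    the integer part of exp t. Conditions (iii) and (iv), given along integers, are carried over to
    real t by the monotonicity of f'. *)

Lemma expR_ge1 {R : realType} (y : R) : (1 <= expR y) = (0 <= y).
Proof. by rewrite -(@expR0 R) ler_expR. Qed.

(** * Jacobi recursions with nondecreasing coefficients *)

Section jacobi_solution.
Context {R : realType} (a : nat -> R) (x : R) (p : nat -> R).
Hypotheses (a_gt0 : forall n, 0 < a n.+1) (a_nd : forall n, a n.+1 <= a n.+2).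
Hypothesis a_lt1 : forall n, a n.+1 < 1.
Hypotheses (p0 : p 0%N = 1) (p1 : x = a 1%N * p 1%N).
Hypothesis pS : forall n, x * p n.+1 = a n.+2 * p n.+2 + a n.+1 * p n.

(* For p_n = p_n(x), this quadratic form in (a_{n+1} p_{n+1}, p_n) increases by
   (a_{n+2}^2 - a_{n+1}^2) p_{n+1}^2 at each step and is positive definite once
   |x| < 2 a_{n+1}. *)
Definition turan n :=
  a n.+1 ^+ 2 * (p n.+1 ^+ 2 + p n ^+ 2) - x * a n.+1 * p n * p n.+1.

Lemma a_homo m n : (m <= n)%N -> a m.+1 <= a n.+1.
Proof.
elim: n => [|n IHn]; first by rewrite leqn0 => /eqP ->.
rewrite leq_eqVlt => /predU1P[->//|]; rewrite ltnS => /IHn h.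
exact: le_trans h (a_nd n).
Qed.

Lemma a_sqr_homo m n : (m <= n)%N -> a m.+1 ^+ 2 <= a n.+1 ^+ 2.
Proof.
by move=> mn; apply: lerXn2r; rewrite ?nnegrE ?(ltW (a_gt0 _))//; exact: a_homo.
Qed.

Lemma a_sqr_le1 n : a n.+1 ^+ 2 <= 1.
Proof. by rewrite expr_le1 ?(ltW (a_gt0 _)) ?(ltW (a_lt1 _)). Qed.

Lemma turan0 : turan 0 = a 1%N ^+ 2.
Proof. by rewrite /turan p0 p1; ring. Qed.

(** Put v = p_{n+1}, u = a_{n+2} p_{n+2} and u' = a_{n+1} p_n. The recursion reads u + u' = x v, so
    u^2 - x u v and u'^2 - x u' v both equal - u u'. Consecutive forms therefore differ only in the
    coefficient of v^2. *)
Lemma turanS n : turan n.+1 =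
  turan n + (a n.+2 ^+ 2 - a n.+1 ^+ 2) * p n.+1 ^+ 2.
Proof.
have h : a n.+2 * p n.+2 = x * p n.+1 - a n.+1 * p n by rewrite pS addrK.
transitivity ((a n.+2 * p n.+2) ^+ 2 + (a n.+2 * p n.+1) ^+ 2
  - x * p n.+1 * (a n.+2 * p n.+2)); first by rewrite /turan; ring.
by rewrite h /turan; ring.
Qed.

Lemma turan_nd m n : (m <= n)%N -> turan m <= turan n.
Proof.
elim: n => [|n IHn]; first by rewrite leqn0 => /eqP ->.
rewrite leq_eqVlt => /predU1P[->//|]; rewrite ltnS => /IHn h.
apply: le_trans h _; rewrite turanS lerDl mulr_ge0 ?sqr_ge0 // subr_ge0.
exact: a_sqr_homo.
Qed.

Lemma turan_ge n : a 1%N ^+ 2 <= turan n.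
Proof. by rewrite -turan0 turan_nd. Qed.

Lemma turan_gt0 n : 0 < turan n.
Proof. by apply: lt_le_trans (turan_ge n); rewrite exprn_gt0. Qed.

Lemma turan_lb n : (a n.+1 ^+ 2 - x ^+ 2 / 4) * p n.+1 ^+ 2 <= turan n.
Proof.
rewrite -subr_ge0 [leRHS](_ : _ = (a n.+1 * p n - x / 2 * p n.+1) ^+ 2).
  exact: sqr_ge0.
by rewrite /turan; field.
Qed.

(** By [turan_lb], the increment of [turan] costs no more than the increment of a_{n+1}^2. The
    inequality is kept free of division, so that the sign of a_{n+1}^2 - x^2/4 does not enter. *)
Lemma turan_step n : turan n.+1 * (a n.+1 ^+ 2 - x ^+ 2 / 4) <=
  turan n * (a n.+2 ^+ 2 - x ^+ 2 / 4).
Proof.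
have h := turan_lb n.
have h2 : 0 <= a n.+2 ^+ 2 - a n.+1 ^+ 2.
  by rewrite subr_ge0 a_sqr_homo.
have := ler_wpM2l h2 h; rewrite turanS => h3; nra.
Qed.

Lemma turan_telescope m n : (m <= n)%N -> 0 < a m.+1 ^+ 2 - x ^+ 2 / 4 ->
  turan n * (a m.+1 ^+ 2 - x ^+ 2 / 4) <= turan m * (a n.+1 ^+ 2 - x ^+ 2 / 4).
Proof.
move=> mn hm; elim: n mn => [|n IHn]; first by rewrite leqn0 => /eqP ->.
rewrite leq_eqVlt => /predU1P[->//|]; rewrite ltnS => mn.
have hn : 0 < a n.+1 ^+ 2 - x ^+ 2 / 4.
  by apply: lt_le_trans hm _; rewrite lerD2r a_sqr_homo.
have hn2 : 0 <= a n.+2 ^+ 2 - x ^+ 2 / 4.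
  by apply: le_trans (ltW hn) _; rewrite lerD2r a_sqr_homo.
have h1 := IHn mn; have h2 := turan_step n.
rewrite -(ler_pM2r hn).
apply: (@le_trans _ _ (turan n * (a n.+2 ^+ 2 - x ^+ 2 / 4) *
   (a m.+1 ^+ 2 - x ^+ 2 / 4))).
  by rewrite mulrAC ler_pM2r.
rewrite mulrAC [leRHS]mulrAC; exact: ler_wpM2r.
Qed.

Lemma turan_bound m n : (m <= n)%N -> 0 < a m.+1 ^+ 2 - x ^+ 2 / 4 ->
  turan n * (a m.+1 ^+ 2 - x ^+ 2 / 4) <= turan m.
Proof.
move=> mn hm; apply: le_trans (turan_telescope _ _ mn hm) _.
rewrite -[leRHS]mulr1 ler_pM2l ?turan_gt0 // lerBlDr.
by rewrite (le_trans (a_sqr_le1 n)) // lerDl divr_ge0 ?sqr_ge0.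
Qed.

(** * Growth of the solution in the hyperbolic region *)

Section hyperbolic_region.
Variables (N : nat) (gam : nat -> R).
Hypothesis gam_ge0 : forall k, (0 < k <= N)%N -> 0 <= gam k.
Hypothesis gamE : forall k, (0 < k <= N)%N ->
  x = a k * (expR (gam k) + expR (- gam k)).

(** [t k] and [s k] are the roots of z^2 - x z + a_k^2, the characteristic roots scaled by a_k;
    [E k] is the product of the large unscaled roots. *)
Let t k := a k * expR (gam k).
Let s k := a k * expR (- gam k).
Let E k := expR (\sum_(1 <= j < k.+1) gam j).

Let a_gt0' k : (0 < k)%N -> 0 < a k.
Proof. by case: k. Qed.

Let t_gt0 k : (0 < k)%N -> 0 < t k.
Proof. by move=> ?; rewrite mulr_gt0 ?expR_gt0 ?a_gt0'. Qed.

Let s_gt0 k : (0 < k)%N -> 0 < s k.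
Proof. by move=> ?; rewrite mulr_gt0 ?expR_gt0 ?a_gt0'. Qed.

Let tDs k : (0 < k <= N)%N -> t k + s k = x.
Proof. by move=> kN; rewrite [RHS](gamE k kN) mulrDr. Qed.

Let tMs k : t k * s k = a k ^+ 2.
Proof.
rewrite /t /s expRN; have := expR_gt0 (gam k) => h; field.
by rewrite gt_eqF.
Qed.

Let s_le_a k : (0 < k <= N)%N -> s k <= a k.
Proof.
move=> kN; rewrite /s ger_pMr ?a_gt0' //; last by case/andP: kN.
by rewrite -[leRHS](@expR0 R) ler_expR oppr_le0 gam_ge0.
Qed.

Let a_le_t k : (0 < k <= N)%N -> a k <= t k.
Proof.
move=> kN; have k0 : (0 < k)%N by case/andP: kN.
by rewrite /t ler_peMr ?(ltW (a_gt0' _ k0)) // expR_ge1 gam_ge0.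
Qed.

(** Raising the constant term a_k^2 of z^2 - x z + a_k^2 moves its two roots towards x/2. If the
    larger root increased from t to t', then (t' - t) (t' + t - x) would be positive, yet it equals
    a_k^2 - a_{k+1}^2. *)
Let t_ni k : (0 < k)%N -> (k.+1 <= N)%N -> t k.+1 <= t k.
Proof.
move=> k0 kN.
have kN1 : (0 < k <= N)%N by rewrite k0 (ltnW kN).
have kN2 : (0 < k.+1 <= N)%N by rewrite kN.
have h1 := tDs _ kN1; have h2 := tDs _ kN2.
have h3 := tMs k; have h4 := tMs k.+1.
have h5 : a k ^+ 2 <= a k.+1 ^+ 2.
  by case: k k0 {kN kN1 kN2 h1 h2 h3 h4} => // k _; rewrite a_sqr_homo.
have h6 : s k <= t k by apply: le_trans (s_le_a _ kN1) (a_le_t _ kN1).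
have h7 : s k.+1 <= t k.+1 by apply: le_trans (s_le_a _ kN2) (a_le_t _ kN2).
rewrite leNgt; apply/negP => lt_t.
have e1 : s k = x - t k by rewrite -h1; ring.
have e2 : s k.+1 = x - t k.+1 by rewrite -h2; ring.
rewrite e1 in h3 h6; rewrite e2 in h4 h7.
suff : 0 < (t k.+1 - t k) * (t k.+1 + t k - x) by nra.
by apply: mulr_gt0; lra.
Qed.

Let ES k : (0 < k)%N -> E k = expR (gam k) * E k.-1.
Proof. by case: k => // k _; rewrite /E big_nat_recr//= expRD mulrC. Qed.

Let E_gt0 k : 0 < E k. Proof. exact: expR_gt0. Qed.

(** Since t s = a^2, the invariant at k gives a_{k+1} p_k <= s_{k+1} p_{k+1}. The recursion with x =
    t_{k+1} + s_{k+1} then leaves a_{k+2} p_{k+2} >= t_{k+1} p_{k+1}, and [t] does not increase. *)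
Let p_growth k : (k.+1 <= N)%N ->
  0 < p k /\ t k.+1 * p k <= a k.+1 * p k.+1.
Proof.
elim: k => [|k IHk] kN.
  rewrite p0 ltr01; split=> //; rewrite mulr1 -p1.
  have kN1 : (0 < 1 <= N)%N by rewrite kN.
  by rewrite -(tDs _ kN1) lerDl ltW // s_gt0.
have {IHk}[pk hk] := IHk (ltnW kN).
have kN1 : (0 < k.+1 <= N)%N := ltnW kN.
have pk1 : 0 < p k.+1.
  rewrite -(pmulr_rgt0 _ (a_gt0 k)); apply: lt_le_trans hk.
  by rewrite mulr_gt0 ?t_gt0.
split => //.
have h1 := t_ni k.+1 isT kN.
apply: (@le_trans _ _ (t k.+1 * p k.+1)); first by rewrite ler_pM2r.
have -> : a k.+2 * p k.+2 = x * p k.+1 - a k.+1 * p k by rewrite pS addrK.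
rewrite -(tDs _ kN1) mulrDl -addrA lerDl subr_ge0.
rewrite -(ler_pM2l (t_gt0 k.+1 isT)) [leRHS]mulrA tMs [leLHS]mulrCA expr2 -[leRHS]mulrA.
by rewrite ler_pM2l.
Qed.

Lemma hyperbolic_p_gt0 k : (k <= N)%N -> 0 < p k.
Proof.
case: k => [|k] kN; first by rewrite p0.
have [pk hk] := p_growth _ kN.
rewrite -(pmulr_rgt0 _ (a_gt0 k)); apply: lt_le_trans hk.
by rewrite mulr_gt0 ?t_gt0.
Qed.

Lemma hyperbolic_lower k : (k <= N)%N -> E k <= p k.
Proof.
elim: k => [|k IHk] kN; first by rewrite /E big_geq // expR0 p0.
rewrite ES //=; have [pk hk] := p_growth _ kN.
apply: (@le_trans _ _ (expR (gam k.+1) * p k)).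
  by rewrite ler_pM2l ?expR_gt0 // IHk // ltnW.
by rewrite -(ler_pM2l (a_gt0 k)) mulrA.
Qed.

Let x_gt0 : (0 < N)%N -> 0 < x.
Proof.
move=> N0; have h : (0 < 1 <= N)%N by rewrite N0.
by rewrite -(tDs _ h) addr_gt0 ?t_gt0 ?s_gt0.
Qed.

(* The component of (p_{k+1}, p_k) along the growing root of the characteristic
   equation is amplified by at most exp(gamma_{k+1}), because the other root
   is nondecreasing in k. *)
Let growing_part k : (k.+1 <= N)%N ->
  a k.+1 * p k.+1 - s k.+1 * p k <= x * E k.
Proof.
elim: k => [|k IHk] kN.
  rewrite p0 mulr1 -p1 /E big_geq // expR0 mulr1 lerBlDr lerDl.
  by rewrite ltW // s_gt0.
have kN1 : (0 < k.+1 <= N)%N := ltnW kN.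
have h := IHk (ltnW kN).
rewrite ES //= mulrCA.
apply: (@le_trans _ _ (expR (gam k.+1) * (a k.+1 * p k.+1 - s k.+1 * p k))).
  2: by rewrite ler_pM2l ?expR_gt0.
have -> : a k.+2 * p k.+2 = x * p k.+1 - a k.+1 * p k by rewrite pS addrK.
have e1 : expR (gam k.+1) * (a k.+1 * p k.+1 - s k.+1 * p k) =
   t k.+1 * p k.+1 - a k.+1 * p k.
  rewrite /t /s expRN; have := expR_gt0 (gam k.+1) => h'; field.
  by rewrite gt_eqF.
rewrite e1 addrAC lerD2r lerBlDr.
have kN2 : (0 < k.+2 <= N)%N by rewrite kN.
have := t_ni k.+1 isT kN; have := tDs _ kN1; have := tDs _ kN2 => h2 h1 h3.
have h4 : s k.+1 <= s k.+2 by lra.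
rewrite -h1 mulrDl lerD2l ler_wpM2r // ltW // hyperbolic_p_gt0 //; exact: ltnW.
Qed.

(** As s <= a, [growing_part] bounds a_{k+1} (p_{k+1} - p_k) by x E_k. Each step thus adds at most
    (x / a_1) E_k, and [E] does not decrease, which yields the linear factor. *)
Lemma hyperbolic_upper k : (k <= N)%N -> p k <= (1 + k%:R * x / a 1%N) * E k.
Proof.
elim: k => [|k IHk] kN.
  by rewrite p0 !mul0r addr0 mul1r /E big_geq // expR0.
have kN1 : (0 < k.+1 <= N)%N by rewrite kN.
have h := IHk (ltnW kN); have hA := growing_part _ kN.
have xg : 0 < x by apply: x_gt0; exact: leq_ltn_trans kN.
have pk := hyperbolic_p_gt0 _ (ltnW kN).
have pk1 := hyperbolic_p_gt0 _ kN.
have e1 : a 1%N * p k.+1 <= a 1%N * p k + x * E k.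
  have h1 : a k.+1 * (p k.+1 - p k) <= x * E k.
    apply: le_trans hA; rewrite mulrBr lerD2l lerN2.
    by apply: ler_wpM2r; [exact: ltW|exact: s_le_a].
  have h2 : a 1%N <= a k.+1 by exact: a_homo.
  have xE : 0 < x * E k by rewrite mulr_gt0.
  (* Replacing a_{k+1} by the smaller a_1 is legitimate only for a nonnegative difference of the
     p's. *)
  have [le_p|lt_p] := leP (p k.+1) (p k).
    by rewrite (le_trans (y := a 1%N * p k)) ?ler_pM2l // lerDl ltW.
  have : a 1%N * (p k.+1 - p k) <= a k.+1 * (p k.+1 - p k).
    by rewrite ler_wpM2r // subr_ge0 ltW.
  lra.
have e2 : p k.+1 <= (1 + k.+1%:R * x / a 1%N) * E k.
  rewrite -(ler_pM2l (a_gt0 0)); apply: le_trans e1 _.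
  apply: (@le_trans _ _ (a 1%N * ((1 + k%:R * x / a 1%N) * E k) + x * E k)).
    by rewrite lerD2r ler_pM2l.
  rewrite -natr1 le_eqVlt; apply/orP; left; apply/eqP; field.
  by rewrite gt_eqF.
apply: le_trans e2 _; rewrite ler_pM2l.
  by rewrite (ES k.+1) // ler_peMl ?expR_ge0 // expR_ge1 gam_ge0.
by rewrite addr_gt0 // divr_gt0 // mulr_gt0.
Qed.

(** Only the last increment of [turan] is kept; its coefficient is later bounded below by a power of
    N. *)
Lemma turan_lower : (0 < N)%N ->
  (a N.+1 ^+ 2 - a N ^+ 2) * E N ^+ 2 <= turan N.
Proof.
move=> N0; have h := hyperbolic_lower N (leqnn N).
have -> : turan N = turan N.-1 + (a N.+1 ^+ 2 - a N ^+ 2) * p N ^+ 2.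
  by rewrite -{1}(prednK N0) turanS prednK.
rewrite -[leLHS]add0r; apply: lerD; first exact/ltW/turan_gt0.
apply: ler_wpM2l.
  by case: N N0 => // n _; rewrite subr_ge0 a_sqr_homo.
by apply: lerXn2r; rewrite ?nnegrE ?(ltW (E_gt0 _)) // ltW ?hyperbolic_p_gt0.
Qed.

(** The index N + 1 lies beyond the range of the gamma_j, so p_{N+1} is bounded by the recursion:
    a_{N+1} p_{N+1} <= x p_N <= 2 p_N because p_{N-1} > 0. The first factor on the right comes from
    turan_{N+1} <= 2 p_{N+1}^2 + p_N^2. *)
Lemma turan_upper : (0 < N)%N -> x <= 2 ->
  turan N.+1 <= (2 * (2 / a 1%N) ^+ 2 + 1) *
                ((1 + N%:R * 2 / a 1%N) * E N) ^+ 2.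
Proof.
move=> N0 x2; have x0 := x_gt0 N0.
have pN := hyperbolic_p_gt0 _ (leqnn N).
have hN := hyperbolic_upper _ (leqnn N).
have pN1 : 0 < p N.-1 by rewrite hyperbolic_p_gt0 // leq_pred.
have e0 : a N.+1 * p N.+1 = x * p N - a N * p N.-1.
  by case: N N0 => // n _; rewrite pS addrK.
have aN : 0 < a N by exact: a_gt0'.
have a11 : a 1%N <= a N.+1 by exact: a_homo.
have a1N : a N <= a N.+1 by case: N N0.
(* One more use of the growth invariant, at N; positivity lets the cross term of [turan] be
   discarded. *)
have pN2 : 0 < p N.+1.
  rewrite -(pmulr_rgt0 _ (a_gt0 N)) e0.
  have := p_growth N.-1; rewrite prednK // => /(_ (leqnn N))[_ h].
  have h0 : (0 < N <= N)%N by rewrite N0 leqnn.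
  rewrite -(tDs _ h0) mulrDl -addrA.
  have h1 : 0 <= s N * p N - a N * p N.-1.
    rewrite subr_ge0 -(ler_pM2l (t_gt0 _ N0)) [leRHS]mulrA tMs.
    by rewrite [leLHS]mulrCA expr2 -[leRHS]mulrA ler_pM2l.
  have h2 : 0 < t N * p N by rewrite mulr_gt0 ?t_gt0.
  lra.
have e1 : p N.+1 <= 2 / a 1%N * p N.
  rewrite -(ler_pM2l (a_gt0 0)).
  rewrite [leRHS](_ : _ = 2 * p N); last by field; rewrite gt_eqF.
  apply: (@le_trans _ _ (a N.+1 * p N.+1)); first by rewrite ler_pM2r.
  rewrite e0; have : 0 < a N * p N.-1 by rewrite mulr_gt0.
  have : x * p N <= 2 * p N by rewrite ler_pM2r.
  lra.
have e2 : p N.+1 ^+ 2 <= (2 / a 1%N) ^+ 2 * p N ^+ 2.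
  rewrite -exprMn; apply: lerXn2r; rewrite ?nnegrE ?(ltW pN2) //.
  by rewrite mulr_ge0 ?divr_ge0 // ?ltW.
have e3 : turan N <= p N.+1 ^+ 2 + p N ^+ 2.
  rewrite /turan lerBlDr.
  have : 0 <= x * a N.+1 * p N * p N.+1 by rewrite !mulr_ge0 // ltW.
  have : a N.+1 ^+ 2 * (p N.+1 ^+ 2 + p N ^+ 2) <= p N.+1 ^+ 2 + p N ^+ 2.
    by rewrite ler_piMl ?addr_ge0 ?sqr_ge0 // a_sqr_le1.
  lra.
have e4 : turan N.+1 <= 2 * p N.+1 ^+ 2 + p N ^+ 2.
  rewrite turanS.
  have : (a N.+2 ^+ 2 - a N.+1 ^+ 2) * p N.+1 ^+ 2 <= p N.+1 ^+ 2.
    rewrite ler_piMl ?sqr_ge0 // lerBlDr (le_trans (a_sqr_le1 _)) //.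
    by rewrite lerDl sqr_ge0.
  lra.
apply: (@le_trans _ _ ((2 * (2 / a 1%N) ^+ 2 + 1) * p N ^+ 2)); first lra.
apply: ler_wpM2l; first by rewrite addr_ge0 // mulr_ge0 // sqr_ge0.
apply: lerXn2r; rewrite ?nnegrE ?(ltW pN) //.
  rewrite mulr_ge0 ?expR_ge0 // addr_ge0 // divr_ge0 ?mulr_ge0 //.
  exact: ltW.
apply: le_trans hN _; rewrite ler_pM2r // lerD2l ler_pM2r ?invr_gt0 //.
by apply: ler_wpM2l.
Qed.

End hyperbolic_region.
End jacobi_solution.

(** * Approximation of a step function and moment determinacy *)

Section step_approximation.
Context {R : realType}.
Implicit Types (y t L : R) (n : nat).

(** With z = sqrt y, Bernoulli's inequality for 1/z bounds n z^n by a constant, and the remaining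
    factor z^n tends to 0. *)
Lemma mulrn_expr_cvg0 y : 0 <= y < 1 -> n%:R * y ^+ n @[n --> \oo] --> (0 : R).
Proof.
move=> /andP[y0 y1].
have [->|yN0] := eqVneq y 0.
  apply: cvg_near_cst; exists 1%N => // -[|n] // _.
  by rewrite expr0n /= mulr0.
have yp : 0 < y by rewrite lt_neqAle eq_sym yN0.
pose z := Num.sqrt y.
have z0 : 0 < z by rewrite sqrtr_gt0.
have z1 : z < 1 by rewrite -[ltRHS]sqrtr1 ltr_sqrt.
have zz : z ^+ 2 = y by rewrite sqr_sqrtr.
have b n : n%:R * z ^+ n <= (z^-1 - 1)^-1.
  have h : 0 < z^-1 - 1 by rewrite subr_gt0 invf_gt1.
  rewrite -[leRHS]mul1r ler_pdivlMr //.
  have bern : 1 + n%:R * (z^-1 - 1) <= z^-1 ^+ n.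
    elim: n => [|n IHn]; first by rewrite mul0r addr0 expr0.
    rewrite exprS.
    apply: (@le_trans _ _ (z^-1 * (1 + n%:R * (z^-1 - 1)))).
      have : 0 <= n%:R * (z^-1 - 1) ^+ 2 by rewrite mulr_ge0 ?sqr_ge0.
      rewrite -natr1; lra.
    by rewrite ler_pM2l // invr_gt0.
  have zn : 0 < z ^+ n by rewrite exprn_gt0.
  have : (1 + n%:R * (z^-1 - 1)) * z ^+ n <= z^-1 ^+ n * z ^+ n.
    by rewrite ler_pM2r.
  rewrite -exprMn mulVf ?gt_eqF // expr1n => h2; lra.
apply: (@squeeze_cvgr _ _ _ _ (cst 0) (fun n => (z^-1 - 1)^-1 * z ^+ n)).
- apply: nearW => n; rewrite mulr_ge0 ?exprn_ge0 //=.
  rewrite -zz exprAC expr2 mulrA ler_pM2r ?exprn_gt0 //.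
- exact: cvg_cst.
- rewrite -[X in _ --> X](mulr0 (z^-1 - 1)^-1).
  apply: cvgMl_tmp; apply: cvg_expr; rewrite ger0_norm ?ltW //.
Qed.

(* Converges to the indicator of y < 1/2 on [0, 1]; without the factor n in the
   exponent the limit at y = 1/2 would be 1/e. *)
Definition step_seq n y : R := (1 - y ^+ n) ^+ (n * 2 ^ n).

Lemma step_seq_itv n y : 0 <= y <= 1 -> 0 <= step_seq n y <= 1.
Proof.
move=> /andP[y0 y1]; rewrite /step_seq.
have h : 0 <= 1 - y ^+ n <= 1.
  by rewrite subr_ge0 exprn_ile1 //= gerBl exprn_ge0.
by case/andP: h => h0 h1; rewrite exprn_ge0 //= exprn_ile1.
Qed.

Lemma onem_expr_ge (z : R) n : 0 <= z <= 1 -> 1 - n%:R * z <= (1 - z) ^+ n.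
Proof.
move=> /andP[z0 z1]; elim: n => [|n IHn]; first by rewrite mul0r subr0 expr0.
rewrite exprS; apply: (@le_trans _ _ ((1 - z) * (1 - n%:R * z))).
  have : 0 <= n%:R * z ^+ 2 by rewrite mulr_ge0 ?sqr_ge0.
  rewrite -natr1; lra.
by rewrite ler_wpM2l // subr_ge0.
Qed.

(** Bernoulli's inequality for 1 + z, together with (1 - z) (1 + z) <= 1. *)
Lemma onem_expr_le (z : R) n : 0 <= z <= 1 -> (1 - z) ^+ n * (1 + n%:R * z) <= 1.
Proof.
move=> /andP[z0 z1].
have h : 1 + n%:R * z <= (1 + z) ^+ n.
  elim: n => [|n IHn]; first by rewrite mul0r addr0 expr0.
  rewrite exprS; apply: (@le_trans _ _ ((1 + z) * (1 + n%:R * z))).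
    have : 0 <= n%:R * z ^+ 2 by rewrite mulr_ge0 ?sqr_ge0.
    rewrite -natr1; lra.
  by rewrite ler_wpM2l // addr_ge0.
apply: (@le_trans _ _ ((1 - z) ^+ n * (1 + z) ^+ n)).
  by rewrite ler_wpM2l // exprn_ge0 // subr_ge0.
rewrite -exprMn exprn_ile1 //; nra.
Qed.

(** The outer exponent times y^n is n (2 y)^n. It tends to 0 for y < 1/2 and is at least n for y >=
    1/2, which decides between the limits 1 and 0. *)
Lemma step_seq_cvg1 y : 0 <= y < 1 / 2 -> step_seq n y @[n --> \oo] --> (1 : R).
Proof.
move=> /andP[y0 y2].
have y1 : y <= 1 by lra.
apply: (@squeeze_cvgr _ _ _ _ (fun n => 1 - n%:R * (2 * y) ^+ n) (cst 1)).
- apply: nearW => n; have h := step_seq_itv n y; rewrite y0 y1 in h.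
  case/andP: (h isT) => _ ->; rewrite andbT /step_seq.
  have hz : 0 <= y ^+ n <= 1 by rewrite exprn_ge0 // exprn_ile1.
  apply: le_trans (onem_expr_ge _ (n * 2 ^ n) hz).
  by rewrite exprMn natrM natrX mulrA.
- rewrite -[X in _ --> X]subr0; apply: cvgB; first exact: cvg_cst.
  apply: mulrn_expr_cvg0; lra.
- exact: cvg_cst.
Qed.

Lemma step_seq_cvg0 y : 1 / 2 <= y <= 1 -> step_seq n y @[n --> \oo] --> (0 : R).
Proof.
move=> /andP[y2 y1]; have y0 : 0 <= y by lra.
apply: (@squeeze_cvgr _ _ _ _ (cst 0) (fun n => n%:R ^-1)).
- exists 1%N => // n /= n0; have h := step_seq_itv n y; rewrite y0 y1 in h.
  case/andP: (h isT) => h0 _; rewrite h0 /=.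
  have hz : 0 <= y ^+ n <= 1 by rewrite exprn_ge0 // exprn_ile1.
  have h1 := onem_expr_le _ (n * 2 ^ n) hz.
  have hn : 0 < n%:R :> R by rewrite ltr0n.
  rewrite -[leRHS]mul1r ler_pdivlMr //; apply: le_trans h1.
  rewrite -/(step_seq n y); apply: ler_wpM2l => //.
  rewrite natrM natrX -mulrA -exprMn.
  have h2 : 1 <= (2 * y) ^+ n by rewrite exprn_ege1 //; lra.
  nra.
- exact: cvg_cst.
- by rewrite -cvg_shiftS; exact: cvg_harmonic.
Qed.

End step_approximation.

(** Packages a density as a measure, so that uniqueness of measures on a generating pi-system can be
    applied to it. *)
Lemma density_measure {d} {T : measurableType d} {R : realType}
    (m : {measure set T -> \bar R}) (f : T -> R) :
  measurable_fun setT f -> (forall x, 0 <= f x) ->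
  exists nu : {measure set T -> \bar R},
    forall A, nu A = (\int[m]_(x in A) (f x)%:E)%E.
Proof.
move=> mf f0.
pose nu (A : set T) := (\int[m]_(x in A) (f x)%:E)%E.
have nu0 : nu set0 = 0%E by rewrite /nu integral_set0.
have nu_ge0 A : (0 <= nu A)%E.
  by apply: integral_ge0 => x _; rewrite lee_fin.
have nu_sigma : semi_sigma_additive nu.
  move=> A mA tA mUA; rewrite /nu ge0_integral_bigcup //=.
  - apply: is_cvg_ereal_nneg_natsum_cond => n _ _.
    exact: nu_ge0.
  - exact/measurable_EFinP/measurable_funTS.
  - by move=> x _; rewrite lee_fin.
pose nuM : {measure set T -> \bar R} :=
  HB.pack nu (isMeasure.Build _ _ _ nu nu0 nu_ge0 nu_sigma).
by exists nuM.
Qed.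

Section determinacy.
Context {R : realType}.
Local Notation TR := (measurableTypeR R).

(** The inner affine map sends t to 1/2; the slope 1/(4 L) keeps it inside [0, 1] when x and t both
    lie in [-L, L]. *)
Definition step_poly (L t : R) n : {poly R} :=
  (1 - ((4 * L)^-1 *: 'X + (1 / 2 - t / (4 * L))%:P) ^+ n) ^+ (n * 2 ^ n).

Lemma step_polyE L t n x :
  (step_poly L t n).[x] = step_seq n ((x - t) / (4 * L) + 1 / 2).
Proof.
rewrite /step_poly /step_seq !hornerE; congr ((_ - _ ^+ _) ^+ _).
by rewrite /= mulrBl [_ * x]mulrC addrAC.
Qed.

Lemma step_poly_arg (L t x : R) : 0 < L -> `|t| <= L -> `|x| <= L ->
  0 <= (x - t) / (4 * L) + 1 / 2 <= 1.
Proof.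
move=> L0; rewrite !ler_norml => /andP[t1 t2] /andP[x1 x2].
have h : (x - t) / (4 * L) * (4 * L) = x - t by rewrite divfK // mulf_neq0 ?gt_eqF.
move: h; set y := (x - t) / _ => h; apply/andP; split; nra.
Qed.

Lemma step_poly_cvg (L t x : R) : 0 < L -> `|t| <= L -> `|x| <= L ->
  (step_poly L t n).[x] @[n --> \oo] --> (\1_(`]-oo, t[%classic : set R) x : R).
Proof.
move=> L0 tL xL; have h := step_poly_arg _ _ _ L0 tL xL.
under eq_fun do rewrite step_polyE.
have L4 : 0 < (4 * L)^-1 by rewrite invr_gt0; lra.
rewrite indicE mem_setE in_itv/=; case: ltP => xt.
- apply: step_seq_cvg1; case/andP: h => -> _ /=.
  have : (x - t) / (4 * L) < 0 by rewrite pmulr_llt0 // subr_lt0.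
  lra.
- apply: step_seq_cvg0; case/andP: h => _ ->; rewrite andbT.
  have : 0 <= (x - t) / (4 * L) by rewrite pmulr_lge0 // subr_ge0.
  lra.
Qed.

Lemma measurable_horner (P : {poly R}) (A : set TR) :
  measurable_fun A (fun x : TR => P.[x]).
Proof.
apply: measurable_funTS; apply: continuous_measurable_fun.
exact: continuous_horner.
Qed.

Lemma integral_step_cvg (m : {measure set TR -> \bar R}) (f : TR -> R)
    (L t : R) : 0 < L -> `|t| <= L ->
  m.-integrable setT (EFin \o f) -> (forall x, 0 <= f x) ->
  {ae m, forall x, f x != 0 -> `|x| <= L} ->
  (\int[m]_x ((step_poly L t n).[x] * f x)%:E)%E @[n --> \oo] -->
  (\int[m]_(x in `]-oo, t[%classic) (f x)%:E)%E.
Proof.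
move=> L0 tL fi f0 fL.
have mf : measurable_fun setT f.
  by apply/measurable_EFinP; exact: measurable_int fi.
rewrite integral_mkcond.
have -> : ((fun x => (f x)%:E) \_ `]-oo, t[%classic)%E =
    (fun x => (\1_(`]-oo, t[%classic : set R) x * f x)%:E).
  apply/funext => x; rewrite /patch indicE.
  by case: ifPn => _; rewrite ?mul1r ?mul0r.
have mi : measurable_fun [set: TR] (\1_(`]-oo, t[%classic : set R) : TR -> R).
  exact: measurable_indic.
have [] // := @dominated_convergence _ TR R m setT measurableT
  (fun n x => ((step_poly L t n).[x] * f x)%:E)
  (fun x => (\1_(`]-oo, t[%classic : set R) x * f x)%:E) (EFin \o f).
- move=> n; apply/measurable_EFinP; apply: measurable_funM => //.
  exact: measurable_horner.
- by apply/measurable_EFinP; exact: measurable_funM.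
- apply: filterS fL => x fL _; apply: cvg_EFin; first exact: nearW.
  have [->|fx] := eqVneq (f x) 0.
    by rewrite mulr0; under eq_fun do rewrite /= mulr0; exact: cvg_cst.
  apply: cvgMr_tmp; exact: step_poly_cvg (fL fx).
- apply: filterS fL => x fL n _; rewrite /= lee_fin.
  have [->|fx] := eqVneq (f x) 0; first by rewrite mulr0 normr0.
  rewrite normrM (ger0_norm (f0 x)) ler_piMl // step_polyE.
  have := step_seq_itv n _ (step_poly_arg _ _ _ L0 tL (fL fx)).
  by case/andP => h0 h1; rewrite ger0_norm.
Qed.

(** The mass of a half-line []-oo, t[] is a limit of integrals of polynomials, and half-lines form a
    generating pi-system. Two base measures with densities are allowed, and the support condition
    bears on the densities, because [turan_lim] against [mu] has to be compared with [semicircle]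
    against Lebesgue measure. *)
Lemma moment_determinacy (m1 m2 : {measure set TR -> \bar R}) (f1 f2 : TR -> R)
    (L : R) :
  m1.-integrable setT (EFin \o f1) -> m2.-integrable setT (EFin \o f2) ->
  (forall x, 0 <= f1 x) -> (forall x, 0 <= f2 x) ->
  {ae m1, forall x, f1 x != 0 -> `|x| <= L} ->
  {ae m2, forall x, f2 x != 0 -> `|x| <= L} ->
  (forall P : {poly R}, (\int[m1]_x (P.[x] * f1 x)%:E =
                         \int[m2]_x (P.[x] * f2 x)%:E)%E) ->
  forall A, measurable A ->
    (\int[m1]_(x in A) (f1 x)%:E = \int[m2]_(x in A) (f2 x)%:E)%E.
Proof.
move=> if1 if2 f10 f20 fL1 fL2 hP A mA.
have mf1 : measurable_fun setT f1.
  by apply/measurable_EFinP; exact: measurable_int if1.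
have mf2 : measurable_fun setT f2.
  by apply/measurable_EFinP; exact: measurable_int if2.
have [nu1 nu1E] := density_measure m1 f1 mf1 f10.
have [nu2 nu2E] := density_measure m2 f2 mf2 f20.
rewrite -nu1E -nu2E.
apply: (@measure_unique _ R TR [set A | exists x : R, A = `]-oo, x[%classic]
  (fun n => `]-oo, n%:R[%classic) _ _ _ _ nu1 nu2) => //.
- exact: RGenInftyO.measurableE.
- move=> _ _ [s ->] [t ->]; exists (Num.min s t).
  by apply/seteqP; split => x /=; rewrite !in_itv/= lt_min => /andP.
- by move=> n; exists n%:R.
- rewrite -subTset => x _.
  exists (Num.truncn `|x|).+1 => //=.
  rewrite in_itv/=; apply: le_lt_trans (ler_norm _) _.
  by rewrite truncnS_gt.
- move=> _ [t ->]; rewrite nu1E nu2E.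
  pose M := `|L| + `|t| + 1.
  have M0 : 0 < M by rewrite /M ltr_pwDr // addr_ge0.
  have tM : `|t| <= M by rewrite /M -addrA addrCA lerDl addr_ge0.
  have LM x : `|x| <= L -> `|x| <= M.
    move=> /le_trans; apply; rewrite /M -addrA; apply: (le_trans (ler_norm L)).
    by rewrite lerDl addr_ge0.
  have fM1 : {ae m1, forall x, f1 x != 0 -> `|x| <= M}.
    by apply: filterS fL1 => x h /h /LM.
  have fM2 : {ae m2, forall x, f2 x != 0 -> `|x| <= M}.
    by apply: filterS fL2 => x h /h /LM.
  have c1 := integral_step_cvg _ _ _ _ M0 tM if1 f10 fM1.
  have c2 := integral_step_cvg _ _ _ _ M0 tM if2 f20 fM2.
  move: c1; under eq_fun do rewrite hP.
  by move=> c1; exact: cvg_unique c1 c2.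
- move=> n; rewrite nu1E.
  have /integrableP[_] : m1.-integrable (`]-oo, n%:R[%classic : set TR)
      (EFin \o f1) by apply: integrableS if1.
  move=> h; rewrite (eq_integral (fun x => `|(EFin \o f1) x|%E)) // => x _.
  by rewrite gee0_abs ?lee_fin ?f10.
Qed.

End determinacy.

(** * Moments of the orthonormal polynomials far from the origin *)

(* chebU k = U_{k-1} is the Chebyshev polynomial of the second kind on [-2, 2],
   normalised by U_{k-1}(2 cos t) = sin (k t) / sin t. *)
Fixpoint chebU {R : realType} (k : nat) : {poly R} :=
  match k with
  | 0 => 0
  | k'.+1 => match k' with
             | 0 => 1
             | k''.+1 => 'X * chebU k' - chebU k''
             end
  end.

Lemma chebUS {R : realType} k : chebU k.+2 = 'X * chebU k.+1 - chebU k :> {poly R}.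
Proof. by []. Qed.

Lemma chebU_monic {R : realType} k :
  (chebU k.+1 : {poly R}) \is monic /\ size (chebU k.+1 : {poly R}) = k.+1.
Proof.
suff : [/\ (chebU k.+1 : {poly R}) \is monic,
  size (chebU k.+1 : {poly R}) = k.+1 & (size (chebU k : {poly R}) <= k)%N].
  by case.
elim: k => [|k [mk sk sk']].
  by split; [exact: monic1|rewrite size_poly1|rewrite size_poly0].
have neq0 : chebU k.+1 != 0 :> {poly R} by rewrite monic_neq0.
have sX : size ('X * chebU k.+1 : {poly R}) = k.+2.
  by rewrite mulrC size_mulX // sk.
have lt : (size (- chebU k : {poly R})%R < size ('X * chebU k.+1 : {poly R})%R)%N.
  by rewrite size_polyN sX ltnS leqW.
split.
- by rewrite chebUS monicE lead_coefDl // mulrC lead_coefMX -monicE.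
- by rewrite chebUS size_polyDl.
- by rewrite sk.
Qed.

(* The limit of the matrix elements of U_{k-1}(J) far from the origin: the free
   matrix is S + S^-1 and U_{k-1}(S + S^-1) = S^(k-1) + S^(k-3) + ... + S^(1-k). *)
Definition chebU_entry (k i j : nat) : bool :=
  (((i - j) + (j - i) < k) && odd (k + i + j))%N.

Lemma chebU_entryS k i j :
  (chebU_entry k.+1 i.+2 j + chebU_entry k.+1 i j =
   chebU_entry k.+2 i.+1 j + chebU_entry k i.+1 j)%N.
Proof. by rewrite /chebU_entry; lia. Qed.

Lemma chebU_entrySS k i j : chebU_entry k i.+1 j.+1 = chebU_entry k i j.
Proof. by rewrite /chebU_entry; lia. Qed.

Lemma compactly_supported_itv {R : realType}
    (mu : probability (measurableTypeR R) R) : compactly_supported mu ->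
  exists2 L : R, 0 < L & {ae mu, forall x, `|x| <= L}.
Proof.
move=> [K [cK muK]]; have [M [_ hM]] := compact_bounded cK.
exists (`|M| + 1); first by rewrite ltr_wpDl.
exists (~` K); split => //.
  by apply: measurableC; exact: compact_measurable.
move=> x /=; apply: contra_not => Kx; apply: hM => //.
by rewrite (le_lt_trans (ler_norm M)) // ltrDl.
Qed.

Section nevai.
Context {R : realType} (mu : probability (measurableTypeR R) R).
Context (p : nat -> {poly R}) (a : nat -> R).
Hypothesis mu_supp : compactly_supported mu.
Hypothesis p_orth : forall m n,
  (\int[mu]_x ((p m).[x] * (p n).[x])%:E = ((m == n)%:R)%:E)%E.
Hypothesis p_rec : forall n,
  'X * p n.+1 = a n.+2 *: p n.+2 + a n.+1 *: p n.
Hypothesis a_cvg : a n @[n --> \oo] --> (1 : R).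

Lemma horner_bounded (P : {poly R}) (L : R) :
  exists2 C, 0 <= C & forall x, `|x| <= L -> `|P.[x]| <= C.
Proof.
have cP : compact ((fun x => P.[x]) @` `[- L, L]).
  apply: continuous_compact; last exact: segment_compact.
  by apply: continuous_subspaceT => x; exact: continuous_horner.
have [M [_ hM]] := compact_bounded cP.
exists (`|M| + 1) => // x; rewrite ler_norml => xL.
apply: hM; first by rewrite (le_lt_trans (ler_norm M)) // ltrDl.
by exists x => //=; rewrite in_itv.
Qed.

Lemma horner_integrable (P : {poly R}) :
  mu.-integrable setT (fun x => (P.[x])%:E).
Proof.
have [L L0 hL] := compactly_supported_itv mu mu_supp.
have [C C0 hC] := horner_bounded P L.
apply/integrableP; split; first by apply/measurable_EFinP; exact: measurable_horner.
apply: (@le_lt_trans _ _ (C%:E * mu setT)%E); last first.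
  by rewrite probability_setT mule1 ltry.
apply: integral_le_bound => //.
  by apply/measurable_EFinP; exact: measurable_horner.
have aeF := ae_filter_ringOfSetsType mu.
by apply: filterS hL => x xL _; rewrite /= lee_fin hC.
Qed.

Definition moment (P : {poly R}) : R := \int[mu]_x P.[x].

Lemma momentE P : (\int[mu]_x (P.[x])%:E)%E = (moment P)%:E.
Proof.
by rewrite /moment /Rintegral fineK //; apply: integrable_fin_num => //;
  exact: horner_integrable.
Qed.

Lemma momentD P Q : moment (P + Q) = moment P + moment Q.
Proof.
rewrite /moment -RintegralD //; [|exact: horner_integrable..].
by apply: eq_Rintegral => x _; rewrite hornerD.
Qed.

Lemma momentZ c P : moment (c *: P) = c * moment P.
Proof.
rewrite /moment -RintegralZl //; last exact: horner_integrable.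
by apply: eq_Rintegral => x _; rewrite hornerZ.
Qed.

Lemma momentB P Q : moment (P - Q) = moment P - moment Q.
Proof. by rewrite momentD -scaleN1r momentZ mulN1r. Qed.

Lemma moment_orth m n : moment (p m * p n) = (m == n)%:R.
Proof.
rewrite -[LHS]/(fine (moment (p m * p n))%:E) -momentE.
by under eq_integral do rewrite hornerM; rewrite p_orth.
Qed.

Let a_shift i : a (n + i)%N @[n --> \oo] --> (1 : R).
Proof. by rewrite (cvg_shiftn i). Qed.

Let stepE (V : {poly R}) n i j :
  moment ('X * V * p (n + i.+1)%N * p (n + j)%N) =
  a (n + i.+2)%N * moment (V * p (n + i.+2)%N * p (n + j)%N) +
  a (n + i.+1)%N * moment (V * p (n + i)%N * p (n + j)%N).
Proof.
have -> : 'X * V * p (n + i.+1)%N * p (n + j)%N =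
    'X * p (n + i.+1)%N * (V * p (n + j)%N) by ring.
have -> : 'X * p (n + i.+1)%N * (V * p (n + j)%N) =
    a (n + i.+2)%N *: (V * p (n + i.+2)%N * p (n + j)%N) +
    a (n + i.+1)%N *: (V * p (n + i)%N * p (n + j)%N).
  rewrite !addnS p_rec mulrDl -!scalerAl; congr (_ *: _ + _ *: _).
    by rewrite mulrCA mulrA.
  by rewrite mulrCA mulrA.
by rewrite momentD !momentZ.
Qed.

(** Multiplication by X is the Jacobi matrix, whose entries tend to those of the free one. Two
    consecutive values of k are carried along because the Chebyshev recursion has order two. *)
Lemma moment_chebU_cvg k i j :
  moment (chebU k * p (n + i)%N * p (n + j)%N) @[n --> \oo] -->
  ((chebU_entry k i j)%:R : R).
Proof.
suff : forall i j,
  moment (chebU k * p (n + i)%N * p (n + j)%N) @[n --> \oo] -->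
  ((chebU_entry k i j)%:R : R) /\
  moment (chebU k.+1 * p (n + i)%N * p (n + j)%N) @[n --> \oo] -->
  ((chebU_entry k.+1 i j)%:R : R).
  by move=> /(_ i j)[].
elim: k {i j} => [|k IHk] i j.
  split.
    rewrite /chebU_entry ltn0 /=; under eq_fun do rewrite !mul0r.
    rewrite (_ : moment 0 = 0); first exact: cvg_cst.
    by rewrite -(scale0r (0 : {poly R})) momentZ mul0r.
  under eq_fun do rewrite /= mul1r moment_orth eqn_add2l.
  rewrite (_ : chebU_entry 1 i j = (i == j)); first exact: cvg_cst.
  by rewrite /chebU_entry; lia.
split; first by have [] := IHk i j.
have main i' j' : moment (chebU k.+2 * p (n + i'.+1)%N * p (n + j')%N)
    @[n --> \oo] --> ((chebU_entry k.+2 i'.+1 j')%:R : R).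
  have -> : ((chebU_entry k.+2 i'.+1 j')%:R : R) =
      1 * (chebU_entry k.+1 i'.+2 j')%:R + 1 * (chebU_entry k.+1 i' j')%:R
      - (chebU_entry k i'.+1 j')%:R.
    by apply/eqP; rewrite !mul1r eq_sym subr_eq -!natrD chebU_entryS.
  under eq_fun do rewrite chebUS 2!mulrBl momentB stepE.
  apply: cvgB; last by have [] := IHk i'.+1 j'.
  apply: cvgD; apply: cvgM; try exact: a_shift.
    by have [] := IHk i'.+2 j'.
  by have [] := IHk i' j'.
case: i => [|i]; last exact: main.
(* At i = 0 the recursion would call for the index n - 1. Shifting n by one replaces (0, j) by (1, j
   + 1), with the same limiting entry. *)
rewrite -chebU_entrySS -cvg_shiftS.
have h := main 0%N j.+1.
under eq_fun do rewrite addSn -addnS [(_.+1 + j)%N]addSn -[(_ + j).+1]addnS.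
exact: h.
Qed.

Definition turan_poly n : {poly R} :=
  (a n.+1 ^+ 2) *: (p n.+1 ^+ 2 + p n ^+ 2) - a n.+1 *: ('X * p n * p n.+1).

Lemma turan_polyE n x :
  (turan_poly n).[x] = turan a x (fun k => (p k).[x]) n.
Proof. by rewrite /turan_poly /turan !hornerE /=; ring. Qed.

(** Once X p_{n+1} is expanded, the limit is the (1,1) entry minus the (2,0) entry. For odd k these
    are 1 when 0 < k and 1 when 2 < k, and both vanish for even k, so only k = 1 survives. These are
    the values that the semicircle law gives to U_{k-1}. *)
Lemma moment_turan_chebU k :
  moment (chebU k * turan_poly n) @[n --> \oo] --> ((k == 1%N)%:R : R).
Proof.
pose T V (n : nat) := a n.+1 ^+ 2 * (moment (V * p (n + 1)%N * p (n + 1)%N)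
    + moment (V * p (n + 0)%N * p (n + 0)%N))
  - a n.+1 * (a n.+2 * moment (V * p (n + 2)%N * p (n + 0)%N)
    + a n.+1 * moment (V * p (n + 0)%N * p (n + 0)%N)).
have e n V : moment (V * turan_poly n) = T V n.
  have -> : V * turan_poly n =
     (a n.+1 ^+ 2) *: (V * p (n + 1)%N * p (n + 1)%N
                       + V * p (n + 0)%N * p (n + 0)%N)
     - a n.+1 *: ('X * V * p (n + 1)%N * p (n + 0)%N).
    rewrite /turan_poly addn1 addn0 mulrBr -!scalerAr; congr (_ *: _ - _ *: _).
      by ring.
    by ring.
  by rewrite momentB !momentZ momentD stepE /T !addn1 !addn0 addn2.
under eq_fun do rewrite e.
have -> : ((k == 1%N)%:R : R) =
    1 ^+ 2 * ((chebU_entry k 1 1)%:R + (chebU_entry k 0 0)%:R)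
    - 1 * (1 * (chebU_entry k 2 0)%:R + 1 * (chebU_entry k 0 0)%:R).
  rewrite expr1n !mul1r opprD addrACA subrr addr0.
  apply/eqP; rewrite eq_sym subr_eq -natrD; apply/eqP; congr (_%:R).
  by rewrite /chebU_entry; lia.
have a1 : a n.+1 @[n --> \oo] --> (1 : R).
  by under eq_fun do rewrite -addn1; exact: a_shift.
have a2 : a n.+2 @[n --> \oo] --> (1 : R).
  by under eq_fun do rewrite -addn2; exact: a_shift.
apply: cvgB.
  apply: cvgM.
    by rewrite expr2; under eq_fun do rewrite expr2; exact: cvgM.
  by apply: cvgD; exact: moment_chebU_cvg.
apply: cvgM => //; apply: cvgD; apply: cvgM => //; exact: moment_chebU_cvg.
Qed.

End nevai.

(** * The semicircle law and its Chebyshev moments *)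

Section semicircle.
Context {R : realType}.
Local Notation leb := (@lebesgue_measure R).

(** [Num.sqrt] is 0 on negative numbers, so the formula vanishes off [-2, 2] without a case split
    and is continuous on the whole line. *)
Definition semicircle (x : R) : R := Num.sqrt (4 - x ^+ 2) / (2 * pi).

Lemma semicircle_ge0 x : 0 <= semicircle x.
Proof. by rewrite divr_ge0 ?sqrtr_ge0 // mulr_ge0 // pi_ge0. Qed.

Lemma semicircle_eq0 x : 2 <= `|x| -> semicircle x = 0.
Proof.
move=> x2; rewrite /semicircle ler0_sqrtr ?mul0r // subr_le0.
rewrite -real_normK ?num_real // (_ : 4 = 2 ^+ 2); last by ring.
by apply: lerXn2r; rewrite ?nnegrE.
Qed.

Lemma continuous_semicircle : continuous semicircle.
Proof.
move=> x; apply: cvgMr_tmp.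
apply: continuous_cvg; first exact: sqrt_continuous.
apply: cvgB; first exact: cvg_cst.
exact: exprn_continuous.
Qed.

Lemma measurable_semicircle (A : set (measurableTypeR R)) :
  measurable_fun A (semicircle : measurableTypeR R -> R).
Proof.
apply: measurable_funTS; apply: continuous_measurable_fun.
exact: continuous_semicircle.
Qed.

Lemma chebU_cos k (t : R) : (chebU k).[2 * cos t] * sin t = sin (k%:R * t).
Proof.
suff : (chebU k).[2 * cos t] * sin t = sin (k%:R * t) /\
       (chebU k.+1).[2 * cos t] * sin t = sin (k.+1%:R * t) by case.
elim: k => [|k [IH1 IH2]].
  by rewrite /= !hornerE sin0.
split => //; rewrite chebUS !hornerE mulrBl -mulrA IH2 IH1.
have -> : k.+2%:R * t = k.+1%:R * t + t by rewrite -(natr1 k.+1); ring.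
have -> : k%:R * t = k.+1%:R * t - t by rewrite -(natr1 k); ring.
by rewrite (sinD (_ * t) t) sinB; ring.
Qed.

Lemma sin_natpi k : sin (k%:R * pi) = 0 :> R.
Proof.
elim: k => [|k IHk]; first by rewrite mul0r sin0.
by rewrite -natr1 mulrDl mul1r sinDpi IHk oppr0.
Qed.

(** The substitution x = 2 cos t on [0, pi] turns the integrand into (2/pi) sin ((k+1) t) sin t =
    (cos (k t) - cos ((k+2) t)) / pi. The antiderivative vanishes at both ends except for k = 0,
    where the first cosine is constant. *)
Lemma semicircle_chebU k :
  (\int[leb]_x ((chebU k.+1).[x] * semicircle x)%:E = ((k == 0%N)%:R)%:E)%E.
Proof.
pose G x := (chebU k.+1).[x] * semicircle x.
have cG : continuous G.
  by move=> x; apply: cvgM; [exact: continuous_horner|exact: continuous_semicircle].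
pose F (t : R) : R := 2 * cos t.
have dF (t : R) : is_derive t 1 F (- (2 * sin t)).
  apply: (is_derive_eq (is_deriveZ 2 (is_derive_cos t))).
  by rewrite /GRing.scale /= mulrN.
have F'E : derive1 F = (fun t => - (2 * sin t)).
  by apply/funext => t; rewrite derive1E; exact: derive_val.
have cF' : continuous (derive1 F).
  rewrite F'E => t; apply: cvgN; apply: cvgMl_tmp; exact: continuous_sin.
have cF : continuous F.
  by move=> t; apply: cvgMl_tmp; exact: continuous_cos.
have F0 : F 0 = 2 by rewrite /F cos0 mulr1.
have Fpi : F pi = -2 by rewrite /F cospi mulrN1.
have -> : (\int[leb]_x ((chebU k.+1).[x] * semicircle x)%:E =
    \int[leb]_(x in `[F pi, F 0%R]) (G x)%:E)%E.
  rewrite [RHS]integral_mkcond; apply: eq_integral => x _.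
  rewrite /patch; case: ifPn => // /negP; rewrite inE/= ?in_itv/= F0 Fpi => h.
  rewrite semicircle_eq0 ?mulr0 // leNgt; apply/negP => h2; apply: h.
  by rewrite -ler_norml ltW.
rewrite (@integration_by_substitution_decreasing R F G 0 pi).
- pose H (t : R) := pi^-1 * (cos (k%:R * t) - cos (k.+2%:R * t)).
  pose Phi (t : R) := pi^-1 * ((if k is 0%N then t else k%:R^-1 * sin (k%:R * t))
     - k.+2%:R^-1 * sin (k.+2%:R * t)).
  transitivity (\int[leb]_(t in `[0%R, pi]) (H t)%:E)%E.
    apply: eq_integral => t; rewrite inE/= ?in_itv/= => /andP[t0 tpi].
    congr EFin; rewrite -[LHS]/(G (F t) * - (derive1 F t)) F'E opprK.
    rewrite /H /G /semicircle /F.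
    have s0 : 0 <= sin t by apply: sin_ge0_pi; rewrite ?in_itv/= t0 tpi.
    have -> : Num.sqrt (4 - (2 * cos t) ^+ 2) = 2 * sin t.
      rewrite (_ : 4 - _ = (2 * sin t) ^+ 2).
        by rewrite sqrtr_sqr ger0_norm // mulr_ge0.
      rewrite exprMn exprMn -[sin t ^+ 2](addrK (cos t ^+ 2)).
      by rewrite [_ + cos t ^+ 2]addrC cos2Dsin2; ring.
    have := chebU_cos k.+1 t => hU.
    transitivity (2 * ((chebU k.+1).[2 * cos t] * sin t) * sin t / pi).
      have alg (u s q : R) : q != 0 ->
        u * (2 * s / (2 * q)) * (2 * s) = 2 * (u * s) * s / q by move=> q0; field.
      by rewrite alg // gt_eqF // pi_gt0.
    rewrite hU.
    have -> : k.+2%:R * t = k.+1%:R * t + t by rewrite -(natr1 k.+1); ring.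
    have -> : k%:R * t = k.+1%:R * t - t by rewrite -(natr1 k); ring.
    by rewrite (cosD (_ * t) t) cosB mulrC; congr (_ * _); ring.
  have dPhi (t : R) : is_derive t 1 Phi (H t).
    have dS (c : R) : c != 0 ->
        is_derive t 1 (fun t => c^-1 * sin (c * t)) (cos (c * t)).
      move=> c0; have d1 : is_derive t 1 (fun t : R => c * t) c.
        apply: (is_derive_eq (is_deriveZ c (is_derive_id t (1 : R)))).
        by rewrite /GRing.scale /= mulr1.
      have d2 := is_derive1_comp (is_derive_sin (c * t)) d1.
      apply: (is_derive_eq (is_deriveZ c^-1 d2)).
      by rewrite /GRing.scale /= mulrCA mulVf // mulr1.
    apply: is_deriveZ; apply: is_deriveB; last exact: dS.
    case: k {G cG H Phi} => [|k]; last exact: dS.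
    by rewrite mul0r cos0; exact: is_derive_id.
  rewrite (@continuous_FTC2 R H Phi 0 pi) ?pi_gt0 //.
  + rewrite -EFinB; congr EFin; rewrite /Phi; case: k {G cG H Phi dPhi} => [|k].
      by rewrite sin_natpi !(mulr0, sin0, subr0) mulVf // (gt_eqF (pi_gt0 R)).
    by rewrite !sin_natpi !(mulr0, sin0, subr0).
  + apply: continuous_subspaceT => t.
    apply: cvgMl_tmp; apply: cvgB;
      (apply: continuous_cvg; first exact: continuous_cos);
      exact: mulrl_continuous.
  + split.
    * by move=> t _; have [] := dPhi t.
    * apply: cvg_at_right_filter; apply: differentiable_continuous.
      by apply/derivable1_diffP; have [] := dPhi 0.
    * apply: cvg_at_left_filter; apply: differentiable_continuous.
      by apply/derivable1_diffP; have [] := dPhi pi.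
  + by move=> t _; rewrite derive1E; exact: derive_val.
- exact: pi_ge0.
- move=> s t sI tI st; rewrite /F ltr_pM2l // ltr_cos //.
- by move=> t _; exact: cF'.
- by apply: cvgP; apply: cvg_at_right_filter; exact: cF'.
- by apply: cvgP; apply: cvg_at_left_filter; exact: cF'.
- split.
  + by move=> t _; have [] := dF t.
  + by apply: cvg_at_right_filter; exact: cF.
  + by apply: cvg_at_left_filter; exact: cF.
- by apply: continuous_subspaceT.
Qed.

End semicircle.

(** * The density of the spectral measure *)

Section jacobi_density.
Context {R : realType} (mu : probability (measurableTypeR R) R).
Context (p : nat -> {poly R}) (a : nat -> R).
Hypothesis mu_supp : compactly_supported mu.
Hypothesis p_orth : forall m n,
  (\int[mu]_x ((p m).[x] * (p n).[x])%:E = ((m == n)%:R)%:E)%E.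
Hypothesis p0 : p 0%N = 1.
Hypothesis p_rec0 : 'X * p 0%N = a 1%N *: p 1%N.
Hypothesis p_rec : forall n,
  'X * p n.+1 = a n.+2 *: p n.+2 + a n.+1 *: p n.
Hypotheses (a_gt0 : forall n, 0 < a n.+1) (a_nd : forall n, a n.+1 <= a n.+2).
Hypothesis a_lt1 : forall n, a n.+1 < 1.
Hypothesis a_cvg : a n @[n --> \oo] --> (1 : R).
Local Notation TR := (measurableTypeR R).
Local Notation leb := (@lebesgue_measure R).
Local Notation T := (turan_poly p a).
Local Notation pv := (fun x k => (p k).[x]).

Let pv0 x : pv x 0%N = 1.
Proof. by rewrite /= p0 hornerE. Qed.

Let pv1 x : x = a 1%N * pv x 1%N.
Proof.
have := congr1 (fun q : {poly R} => q.[x]) p_rec0.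
by rewrite /= hornerM hornerX hornerZ p0 hornerE mulr1.
Qed.

Let pvS x n : x * pv x n.+1 = a n.+2 * pv x n.+2 + a n.+1 * pv x n.
Proof.
have := congr1 (fun q : {poly R} => q.[x]) (p_rec n).
by rewrite /= hornerM hornerX hornerD !hornerZ.
Qed.

Lemma turan_poly_nd x m n : (m <= n)%N -> (T m).[x] <= (T n).[x].
Proof. by move=> mn; rewrite !turan_polyE; apply: turan_nd. Qed.

Lemma turan_poly_ge x n : a 1%N ^+ 2 <= (T n).[x].
Proof. by rewrite turan_polyE; apply: turan_ge. Qed.

(** In the extended reals, monotonicity gives the limit at every x. It is finite [mu]-almost
    everywhere by integrability and at every point of (-2, 2) by [turan_bound]; [turan_lim] is 0
    wherever it is infinite. *)
Definition turan_elim (x : R) : \bar R := limn (fun n => ((T n).[x])%:E).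
Definition turan_lim (x : R) : R := fine (turan_elim x).

Lemma turan_elim_cvg x : ((T n).[x])%:E @[n --> \oo] --> turan_elim x.
Proof.
by apply: ereal_nondecreasing_is_cvgn => m n mn; rewrite lee_fin turan_poly_nd.
Qed.

Lemma turan_elim_le x n : (((T n).[x])%:E <= turan_elim x)%E.
Proof.
apply: lime_ge; first by apply: cvgP; exact: turan_elim_cvg.
by exists n => // m /= nm; rewrite lee_fin turan_poly_nd.
Qed.

Lemma turan_elim_ge x : ((a 1%N ^+ 2)%:E <= turan_elim x)%E.
Proof. by apply: le_trans (turan_elim_le x 0); rewrite lee_fin turan_poly_ge. Qed.

Lemma turan_elim_ge0 x : (0 <= turan_elim x)%E.
Proof. by apply: le_trans (turan_elim_ge x); rewrite lee_fin sqr_ge0. Qed.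

Lemma measurable_turan_elim : measurable_fun [set: TR] turan_elim.
Proof.
apply: (@emeasurable_fun_cvg _ _ _ _ (fun n x => ((T n).[x])%:E)).
  by move=> n; apply/measurable_EFinP; exact: measurable_horner.
by move=> x _; exact: turan_elim_cvg.
Qed.

Lemma measurable_turan_lim : measurable_fun [set: TR] turan_lim.
Proof. by apply: measurableT_comp => //; exact: measurable_turan_elim. Qed.

Lemma turan_lim_ge0 x : 0 <= turan_lim x.
Proof. exact/fine_ge0/turan_elim_ge0. Qed.

(** Monotone convergence for the constant polynomial U_0. The integrability obtained here makes
    [turan_lim], up to a constant, a dominating function for every other polynomial. *)
Lemma integral_turan_elim : (\int[mu]_x turan_elim x = 1)%E.
Proof.
have h1 : (\int[mu]_x ((T n).[x])%:E)%E @[n --> \oo] --> (\int[mu]_x turan_elim x)%E.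
  apply: cvg_monotone_convergence => //.
  - by move=> n; apply/measurable_EFinP; exact: measurable_horner.
  - by move=> n x _; rewrite lee_fin (le_trans _ (turan_poly_ge x n)) // sqr_ge0.
  - by move=> x _ m n mn; rewrite lee_fin turan_poly_nd.
have h2 := moment_turan_chebU mu p a mu_supp p_orth p_rec a_cvg 1.
have h3 : (\int[mu]_x ((T n).[x])%:E)%E @[n --> \oo] --> (1 : \bar R)%E.
  under eq_fun do rewrite (momentE mu mu_supp) -[T _]mul1r.
  by apply: cvg_EFin; [exact: nearW|exact: h2].
exact: cvg_unique h1 h3.
Qed.

Lemma turan_elim_integrable : mu.-integrable setT turan_elim.
Proof.
apply/integrableP; split; first exact: measurable_turan_elim.
under eq_integral do rewrite gee0_abs ?turan_elim_ge0 //.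
by rewrite integral_turan_elim ltry.
Qed.

Lemma turan_elim_ae : {ae mu, forall x, turan_elim x = (turan_lim x)%:E}.
Proof.
have h := integrable_ae measurableT turan_elim_integrable.
have aeF := ae_filter_ringOfSetsType mu.
by apply: filterS h => x /(_ Logic.I) h; rewrite /turan_lim fineK.
Qed.

Lemma integral_turan_lim A : measurable A ->
  (\int[mu]_(x in A) (turan_lim x)%:E = \int[mu]_(x in A) turan_elim x)%E.
Proof.
move=> mA; apply: ae_eq_integral => //.
- by apply: measurable_funTS; apply/measurable_EFinP; exact: measurable_turan_lim.
- by apply: measurable_funTS; exact: measurable_turan_elim.
- have aeF := ae_filter_ringOfSetsType mu.
  by apply: filterS turan_elim_ae => x ->.
Qed.

Lemma turan_lim_integrable : mu.-integrable setT (EFin \o turan_lim).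
Proof.
apply/integrableP; split.
  by apply/measurable_EFinP; exact: measurable_turan_lim.
rewrite (eq_integral (fun x : TR => (turan_lim x)%:E)); last first.
  by move=> x _; rewrite gee0_abs // lee_fin turan_lim_ge0.
by rewrite integral_turan_lim // integral_turan_elim ltry.
Qed.

Lemma moment_turan_cvg P : (moment mu (P * T n))%:E @[n --> \oo] -->
  (\int[mu]_x (P.[x] * turan_lim x)%:E)%E.
Proof.
have [L L0 hL] := compactly_supported_itv mu mu_supp.
have [C C0 hC] := horner_bounded P L.
have aeF := ae_filter_ringOfSetsType mu.
have [] // := @dominated_convergence _ TR R mu setT measurableT
  (fun n x => ((P * T n).[x])%:E) (fun x => (P.[x] * turan_lim x)%:E)
  (fun x => C%:E * (EFin \o turan_lim) x)%E.
- by move=> n; apply/measurable_EFinP; exact: measurable_horner.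
- apply/measurable_EFinP; apply: measurable_funM.
    exact: measurable_horner.
  exact: measurable_turan_lim.
- apply: filterS turan_elim_ae => x hx _; apply: cvg_EFin; first exact: nearW.
  under eq_fun do rewrite /= hornerM.
  apply: cvgMl_tmp; have := turan_elim_cvg x; rewrite hx.
  by move=> /fine_cvgP[_].
- by apply: integrableZl => //; exact: turan_lim_integrable.
- apply: filterS2 hL turan_elim_ae => x xL hx n _.
  rewrite /= -EFinM lee_fin hornerM normrM; apply: ler_pM => //.
    exact: hC.
  rewrite ger0_norm; last by rewrite (le_trans _ (turan_poly_ge x n)) // sqr_ge0.
  by have := turan_elim_le x n; rewrite hx lee_fin.
move=> _ _ h; under eq_fun do rewrite -(momentE mu mu_supp).
exact: h.
Qed.

Lemma semicircle_horner_integrable P :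
  leb.-integrable setT (fun x => (P.[x] * semicircle x)%:E).
Proof.
have -> : (fun x : R => (P.[x] * semicircle x)%:E) =
    ((fun x : R => (P.[x] * semicircle x)%:E) \_ `[(-2)%R, 2%R]%classic)%E.
  apply/funext => x; rewrite /patch; case: ifPn => // /negP.
  rewrite inE/= ?in_itv/= => h.
  rewrite semicircle_eq0 ?mulr0 // leNgt; apply/negP => h2; apply: h.
  by rewrite -ler_norml ltW.
apply/(integrable_mkcond _ _).1 => //.
apply: continuous_compact_integrable; first exact: segment_compact.
apply: continuous_subspaceT => x; apply: cvgM; first exact: continuous_horner.
exact: continuous_semicircle.
Qed.

(* Both sides are linear in P and agree on the Chebyshev polynomials. *)
Lemma moment_turan_semicircle P : (moment mu (P * T n))%:E @[n --> \oo] -->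
  (\int[leb]_x (P.[x] * semicircle x)%:E)%E.
Proof.
have [n] := ubnP (size P); elim: n P => // n IHn P; rewrite ltnS => sP.
case: n IHn sP => [|n] IHn sP.
  move: sP; rewrite leqn0 size_poly_eq0 => /eqP ->.
  have m0 : moment mu 0 = 0.
    by rewrite -(scale0r (0 : {poly R})) (momentZ mu mu_supp) mul0r.
  under eq_fun do rewrite mul0r m0.
  under eq_integral do rewrite horner0 mul0r.
  by rewrite integral0; exact: cvg_cst.
pose c := P`_n; pose Q := P - c *: chebU n.+1.
have [mU sU] := @chebU_monic R n.
have sQ : (size Q < n.+1)%N.
  rewrite ltnS; apply/leq_sizeP => j nj.
  rewrite /Q coefB coefZ; move: nj; rewrite leq_eqVlt => /predU1P[<-|nj].
    by move: mU; rewrite monicE lead_coefE sU /= => /eqP ->; rewrite mulr1 subrr.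
  rewrite !nth_default ?mulr0 ?subr0 //; first by rewrite sU.
  exact: leq_trans sP _.
have PE : P = Q + c *: chebU n.+1 by rewrite /Q subrK.
clearbody c Q; rewrite {P sP}PE; have hQ := IHn Q sQ.
have hU := moment_turan_chebU mu p a mu_supp p_orth p_rec a_cvg n.+1.
have -> : (\int[leb]_x ((Q + c *: chebU n.+1).[x] * semicircle x)%:E)%E =
    (\int[leb]_x (Q.[x] * semicircle x)%:E + (c * (n.+1 == 1%N)%:R)%:E)%E.
  rewrite EFinM eqSS -semicircle_chebU -integralZl //; last first.
    exact: semicircle_horner_integrable.
  rewrite -integralD //; last 2 first.
  - exact: semicircle_horner_integrable.
  - by apply: integrableZl => //; exact: semicircle_horner_integrable.
  apply: eq_integral => x _.
  by rewrite -EFinM -EFinD hornerD hornerZ mulrDl -mulrA.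
under eq_fun do rewrite mulrDl -scalerAl (momentD mu mu_supp) (momentZ mu mu_supp) EFinD.
apply: cvgeD => //.
  by rewrite fin_num_adde_defl.
by apply: cvg_EFin; [exact: nearW|apply: cvgMl_tmp; exact: hU].
Qed.

Lemma turan_lim_semicircle A : measurable A ->
  (\int[mu]_(x in A) (turan_lim x)%:E =
   \int[leb]_(x in A) (semicircle x)%:E)%E.
Proof.
have [L L0 hL] := compactly_supported_itv mu mu_supp.
apply: (moment_determinacy mu leb turan_lim semicircle (Num.max L 2)).
- exact: turan_lim_integrable.
- have := semicircle_horner_integrable 1.
  by under eq_fun do rewrite hornerC mul1r.
- exact: turan_lim_ge0.
- exact: semicircle_ge0.
- have aeF := ae_filter_ringOfSetsType mu.
  by apply: filterS hL => x xL _; rewrite le_max xL.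
- apply: aeW => x; case: eqP => // s0 _; rewrite le_max.
  have [h|h] := leP 2 `|x|; last by rewrite (ltW h) orbT.
  by case: s0; exact: semicircle_eq0.
- move=> P; exact: cvg_unique (moment_turan_cvg P) (moment_turan_semicircle P).
Qed.

(** The forms increase from a_1^2, which bounds [turan_elim] away from 0. Hence [mu] is absolutely
    continuous and does not charge the complement of (-2, 2). *)
Lemma mu_le_semicircle A : measurable A ->
  ((a 1%N ^+ 2)%:E * mu A <= \int[leb]_(x in A) (semicircle x)%:E)%E.
Proof.
move=> mA; rewrite -turan_lim_semicircle // integral_turan_lim //.
rewrite -integral_cst //; apply: ge0_le_integral => //.
- by move=> x _ /=; rewrite lee_fin sqr_ge0.
- by apply: measurable_funTS; exact: measurable_turan_elim.
- by move=> x _; exact: turan_elim_ge.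
Qed.

Lemma mu_eq0 A : measurable A ->
  (\int[leb]_(x in A) (semicircle x)%:E = 0)%E -> (mu A = 0)%E.
Proof.
move=> mA h; have := mu_le_semicircle A mA; rewrite h.
by rewrite pmule_rle0 ?lte_fin ?exprn_gt0 // measure_le0 => /eqP.
Qed.

Lemma mu_dominated : (mu : set TR -> \bar R) `<< (leb : set TR -> \bar R).
Proof.
apply/null_content_dominatesP => A mA A0; apply: mu_eq0 => //.
apply: null_set_integral => //.
by apply/measurable_EFinP; exact: measurable_semicircle.
Qed.


Definition jacobi_weight (x : R) : R :=
  if -2 < x < 2 then semicircle x / turan_lim x else 0.

Lemma jacobi_weight_ge0 x : 0 <= jacobi_weight x.
Proof.
by rewrite /jacobi_weight; case: ifP => // _;
  rewrite divr_ge0 ?semicircle_ge0 ?turan_lim_ge0.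
Qed.

Lemma jacobi_weightE x : jacobi_weight x = semicircle x / turan_lim x.
Proof.
rewrite /jacobi_weight; case: ifPn => // h; rewrite semicircle_eq0 ?mul0r //.
by rewrite leNgt ltr_norml.
Qed.

Lemma measurable_jacobi_weight : measurable_fun [set: TR] jacobi_weight.
Proof.
(* The inverse is written as a real power, a measurable function; the two agree on nonnegative
   numbers, 0 included. *)
rewrite (_ : jacobi_weight = fun x => semicircle x * turan_lim x `^ (-1)).
  2: by apply/funext => x; rewrite jacobi_weightE powR_inv1 // turan_lim_ge0.
apply: measurable_funM; first exact: measurable_semicircle.
apply: (measurableT_comp (measurable_powR (-1))).
exact: measurable_turan_lim.
Qed.

Lemma turan_poly_bound x m n : (m <= n)%N -> 0 < a m.+1 ^+ 2 - x ^+ 2 / 4 ->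
  (T n).[x] * (a m.+1 ^+ 2 - x ^+ 2 / 4) <= (T m).[x].
Proof. by move=> mn hm; rewrite !turan_polyE; apply: turan_bound. Qed.

Lemma turan_lim_finE x m : 0 < a m.+1 ^+ 2 - x ^+ 2 / 4 ->
  turan_elim x = (turan_lim x)%:E.
Proof.
move=> hm; rewrite /turan_lim fineK // ge0_fin_numE ?turan_elim_ge0 //.
apply: (@le_lt_trans _ _ ((T m).[x] / (a m.+1 ^+ 2 - x ^+ 2 / 4))%:E).
  2: exact: ltry.
apply: lime_le; first by apply: cvgP; exact: turan_elim_cvg.
exists m => // n /= mn; rewrite lee_fin ler_pdivlMr //.
exact: turan_poly_bound.
Qed.

Lemma a_sqr_near (x : R) : `|x| < 2 ->
  exists m, 0 < a m.+1 ^+ 2 - x ^+ 2 / 4.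
Proof.
move=> x2; have h : a n.+1 @[n --> \oo] --> (1 : R) by rewrite (cvg_shiftS a).
have : `|x| / 2 < 1 by rewrite ltr_pdivrMr // mul1r.
move=> /(cvgr_gt (1 : R) h)[m _ /(_ m (leqnn m))/= hm].
exists m; rewrite subr_gt0 -real_normK ?num_real // (_ : 4 = 2 ^+ 2); last by ring.
rewrite -expr_div_n ltr_pXn2r // ?nnegrE ?divr_ge0 //.
exact/ltW.
Qed.

Lemma turan_lim_ge x n : `|x| < 2 -> (T n).[x] <= turan_lim x.
Proof.
move=> /a_sqr_near[m hm]; have := turan_elim_le x n.
by rewrite (turan_lim_finE x m hm) lee_fin.
Qed.

Lemma turan_lim_gt0 x : `|x| < 2 -> 0 < turan_lim x.
Proof.
move=> x2; apply: lt_le_trans (turan_lim_ge x 0 x2).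
by apply: lt_le_trans (turan_poly_ge x 0); rewrite exprn_gt0.
Qed.

Lemma turan_lim_le x m : 0 < a m.+1 ^+ 2 - x ^+ 2 / 4 ->
  turan_lim x * (a m.+1 ^+ 2 - x ^+ 2 / 4) <= (T m).[x].
Proof.
move=> hm; rewrite -ler_pdivlMr //.
rewrite -lee_fin -(turan_lim_finE x m hm).
apply: lime_le; first by apply: cvgP; exact: turan_elim_cvg.
exists m => // n /= mn; rewrite lee_fin ler_pdivlMr //.
exact: turan_poly_bound.
Qed.

(* The identity of turan_lim_semicircle, turan_lim dmu = semicircle dx, is inverted
   by comparing it with the Radon-Nikodym derivative of mu. *)
Lemma jacobi_weight_density : is_density mu jacobi_weight.
Proof.
split; [exact: measurable_jacobi_weight|exact: jacobi_weight_ge0|].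
move=> A mA0; have {mA0}mA : @measurable _ TR A := mA0.
pose I : set TR := [set x | -2 < x < 2].
have IE : I = `]-2, 2[%classic by apply/seteqP; split => x; rewrite /I /= in_itv.
have mI : measurable I by rewrite IE; exact: measurable_itv.
have mAI : measurable (A `&` I) by exact: measurableI.
have mAD : measurable (A `\` I) by exact: measurableD.
have muAD : mu (A `\` I) = 0%E.
  apply: mu_eq0 => //; apply: integral0_eq => x [_ /negP]; rewrite -ltr_norml.
  by rewrite -leNgt => h; rewrite semicircle_eq0.
pose rho := Radon_Nikodym_SigmaFinite.f mu leb.
have rho_int := Radon_Nikodym_SigmaFinite.f_integrable mu_dominated.
have rho_fin := Radon_Nikodym_SigmaFinite.f_fin_num mu_dominated.
have rho0 := Radon_Nikodym_SigmaFinite.f_ge0 mu_dominated.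
have mrho := measurable_int _ rho_int.
have mS : measurable_fun [set: TR] (EFin \o semicircle).
  by apply/measurable_EFinP; exact: measurable_semicircle.
have mD : measurable_fun [set: TR] (EFin \o turan_lim).
  by apply/measurable_EFinP; exact: measurable_turan_lim.
have S_int : leb.-integrable [set: TR] (EFin \o semicircle).
  have := semicircle_horner_integrable 1.
  by under eq_fun do rewrite hornerC mul1r.
have aeE : ae_eq leb [set: TR] (EFin \o semicircle)
    (fun x => (turan_lim x)%:E * rho x)%E.
  apply: integral_ae_eq => //.
    exact: emeasurable_funM.
  move=> E _ mE; rewrite -turan_lim_semicircle //.
  rewrite /rho Radon_Nikodym_SigmaFinite.change_of_variables //.
  - exact: mu_dominated.
  - by move=> x; rewrite lee_fin turan_lim_ge0.
  - exact: measurable_funTS.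
have -> : mu A = (\int[leb]_(x in A `&` I) rho x)%E.
  rewrite -(Radon_Nikodym_SigmaFinite.f_integral mu_dominated) //.
  by rewrite (measureDI mu mA mI) [X in (X + _)%E]muAD add0e.
have -> : (\int[leb]_(x in A) (jacobi_weight x)%:E =
    \int[leb]_(x in A `&` I) (jacobi_weight x)%:E)%E.
  rewrite [LHS]integral_mkcond [RHS]integral_mkcond; apply: eq_integral => x _.
  rewrite /patch in_setI; case: (x \in A) => //=; case: ifPn => // /negP.
  by rewrite inE /= => /negP h; rewrite /jacobi_weight (negbTE h).
apply: ae_eq_integral => //.
- exact: measurable_funTS.
- by apply: measurable_funTS; apply/measurable_EFinP; exact: measurable_jacobi_weight.
have aeF := ae_filter_ringOfSetsType leb.
apply: filterS aeE => x /= /(_ Logic.I) e [_ xI].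
have x2 : `|x| < 2 by rewrite ltr_norml.
rewrite jacobi_weightE -[rho x]fineK ?rho_fin //; congr EFin.
move: e; rewrite -[rho x]fineK ?rho_fin // -EFinM => -[->].
by rewrite mulrC mulKf // gt_eqF // turan_lim_gt0.
Qed.

(** The convergence is uniform for |x| <= r: [turan_telescope] bounds the tail after m by T_m (1 -
    a_{m+1}^2) / (a_{m+1}^2 - x^2/4). On that interval [c] bounds the denominators below and T_m <=
    C / c, whence the factor C / c^2. *)
Lemma turan_lim_continuous x0 : `|x0| < 2 -> {for x0, continuous turan_lim}.
Proof.
move=> x02; pose r := (`|x0| + 2) / 2.
have r0 : `|x0| < r by rewrite /r; lra.
have r2 : r < 2 by rewrite /r; lra.
have rge0 : 0 <= r by apply: le_trans (ltW r0).
have [m0 hm0] : exists m, 0 < a m.+1 ^+ 2 - r ^+ 2 / 4.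
  by apply: a_sqr_near; rewrite ger0_norm.
pose c := a m0.+1 ^+ 2 - r ^+ 2 / 4.
have sq x : `|x| <= r -> x ^+ 2 <= r ^+ 2.
  by move=> xr; rewrite -(real_normK (num_real x)); apply: lerXn2r; rewrite ?nnegrE.
have cm x m : `|x| <= r -> (m0 <= m)%N -> c <= a m.+1 ^+ 2 - x ^+ 2 / 4.
  move=> xr mm; have := a_sqr_homo a a_gt0 a_nd _ _ mm; have := sq _ xr.
  rewrite /c; lra.
have [C C0 hC] := horner_bounded (T m0) r.
have tail x m : `|x| <= r -> (m0 <= m)%N ->
    `|turan_lim x - (T m).[x]| <= C / c ^+ 2 * (1 - a m.+1 ^+ 2).
  move=> xr mm; have x2 : `|x| < 2 by exact: le_lt_trans xr r2.
  have hm := cm x m xr mm.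
  have hmp : 0 < a m.+1 ^+ 2 - x ^+ 2 / 4 by apply: lt_le_trans hm.
  have hT : (T m).[x] <= C / c.
    rewrite ler_pdivlMr //.
    apply: (@le_trans _ _ ((T m).[x] * (a m0.+1 ^+ 2 - x ^+ 2 / 4))).
      apply: ler_wpM2l; last exact: cm.
      by rewrite (le_trans _ (turan_poly_ge x m)) // sqr_ge0.
    apply: (le_trans (turan_poly_bound x m0 m mm (lt_le_trans hm0 (cm x m0 xr (leqnn _))))).
    by apply: le_trans (hC x xr); exact: ler_norm.
  rewrite ger0_norm; last by rewrite subr_ge0 turan_lim_ge.
  have h1 : (turan_lim x - (T m).[x]) * (a m.+1 ^+ 2 - x ^+ 2 / 4) <=
      (T m).[x] * (1 - a m.+1 ^+ 2).
    have e : turan_lim x * (a m.+1 ^+ 2 - x ^+ 2 / 4) <=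
        (T m).[x] * (1 - x ^+ 2 / 4).
      rewrite -ler_pdivlMr // -lee_fin -(turan_lim_finE x m hmp).
      apply: lime_le; first by apply: cvgP; exact: turan_elim_cvg.
      exists m => // n /= mn; rewrite lee_fin ler_pdivlMr // !turan_polyE.
      have h : turan a x (pv x) n * (a m.+1 ^+ 2 - x ^+ 2 / 4) <=
          turan a x (pv x) m * (a n.+1 ^+ 2 - x ^+ 2 / 4).
        by apply: turan_telescope.
      apply: le_trans h _; apply: ler_wpM2l.
        by rewrite -turan_polyE (le_trans _ (turan_poly_ge x m)) // sqr_ge0.
      by rewrite lerD2r a_sqr_le1.
    rewrite mulrBl lerBlDr; apply: le_trans e _.
    by rewrite le_eqVlt; apply/orP; left; apply/eqP; ring.
  have a1 : 0 <= 1 - a m.+1 ^+ 2 by rewrite subr_ge0 a_sqr_le1.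
  rewrite -(ler_pM2r hmp); apply: le_trans h1 _.
  apply: (@le_trans _ _ (C / c * (1 - a m.+1 ^+ 2))); first exact: ler_wpM2r.
  have -> : C / c * (1 - a m.+1 ^+ 2) = C / c ^+ 2 * (1 - a m.+1 ^+ 2) * c.
    by field; rewrite gt_eqF.
  apply: ler_wpM2l => //; apply: mulr_ge0 => //.
  by rewrite divr_ge0 // exprn_ge0 // ltW.
apply/cvgrPdist_le => /= e e0.
have cv : C / c ^+ 2 * (1 - a m.+1 ^+ 2) @[m --> \oo] --> (0 : R).
  have -> : (0 : R) = C / c ^+ 2 * (1 - 1 * 1) by rewrite mul1r subrr mulr0.
  under eq_fun do rewrite expr2.
  have h : a n.+1 @[n --> \oo] --> (1 : R) by rewrite (cvg_shiftS a).
  apply: cvgMl_tmp; apply: cvgB; first exact: cvg_cst.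
  exact: cvgM.
have e3 : 0 < e / 3 by rewrite divr_gt0.
have [m1 _ hm1] := cvgr_lt (0 : R) cv (e / 3) e3.
pose m := maxn m0 m1.
have tm x : `|x| <= r -> `|turan_lim x - (T m).[x]| <= e / 3.
  move=> xr; apply: le_trans (tail x m xr (leq_maxl _ _)) _.
  by apply/ltW/hm1; exact: leq_maxr.
have cT := @continuous_horner R (T m) x0.
have /cvgrPdist_le/(_ _ e3) := cT.
have nr : \forall x \near x0, `|x| <= r.
  have : {for x0, continuous (fun x : R => `|x|)} by exact: norm_continuous.
  move=> /cvgr_le; exact.
move=> nT; near=> x.
have h1 := tm x0 (ltW r0).
have xr : `|x| <= r by near: x.
have h2 := tm x xr.
have h3 : `|(T m).[x0] - (T m).[x]| <= e / 3 by near: x.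
move: h1 h2 h3; rewrite !ler_norml => /andP[h11 h12] /andP[h21 h22] /andP[h31 h32].
apply/andP; split; lra.
Unshelve. all: by end_near. Qed.

Lemma jacobi_weight_continuous x : `|x| < 2 -> {for x, continuous jacobi_weight}.
Proof.
move=> x2; rewrite (_ : jacobi_weight = fun x => semicircle x * (turan_lim x)^-1); last first.
  by apply/funext => y; exact: jacobi_weightE.
apply: cvgM; first exact: continuous_semicircle.
by apply: cvgV; [rewrite gt_eqF // turan_lim_gt0|exact: turan_lim_continuous].
Qed.

End jacobi_density.

(** * The profile f and the Jacobi coefficients near infinity *)

Section derive_within.
Context {R : realType} (D : set R) (f : R -> R) (x : R).
Hypothesis df : derivable_within D f x.

Let q y := (f y - f x) / (y - x).

Let q_cvg : q y @[y --> within D x^'] --> derive_within D f x.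
Proof. exact: df. Qed.

Let q_near e : 0 < e ->
  \forall y \near x, y != x -> D y -> `|derive_within D f x - q y| <= e.
Proof.
by move=> e0; move/cvgrPdist_le: q_cvg => /(_ _ e0).
Qed.

Lemma derivable_within_near_continuous e : 0 < e ->
  \forall y \near x, D y -> `|f x - f y| <= e.
Proof.
move=> e0; set l := derive_within D f x.
have c0 : 0 < `|l| + 1 by rewrite ltr_wpDl.
have near1 := q_near 1 ltr01.
have near2 : \forall y \near x, `|x - y| <= e / (`|l| + 1).
  have : id y @[y --> x] --> x by exact: cvg_id.
  by move=> /cvgrPdist_le /(_ _ (divr_gt0 e0 c0)).
near=> y => Dy.
have [->|yx] := eqVneq y x; first by rewrite subrr normr0 ltW.
have h1 : `|l - q y| <= 1 by move: yx Dy; near: y.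
have h2 : `|x - y| <= e / (`|l| + 1) by near: y.
have -> : f x - f y = q y * (x - y).
  rewrite /q -[x - y]opprB mulrN divfK ?opprB // subr_eq0 //.
rewrite normrM; apply: (@le_trans _ _ ((`|l| + 1) * (e / (`|l| + 1)))).
  apply: ler_pM => //.
  have -> : q y = l - (l - q y) by rewrite opprB addrC subrK.
  by apply: (le_trans (ler_normB _ _)); rewrite lerD2l.
by rewrite mulrC divfK // gt_eqF.
Unshelve. all: by end_near. Qed.

Lemma derivable_within_is_derive :
  nbhs x D -> is_derive x 1 f (derive_within D f x).
Proof.
move=> nD; set l := derive_within D f x.
have H : h^-1 *: (f (h *: 1 + x) - f x) @[h --> (0 : R)^'] --> l.
  apply/cvgrPdist_le => e e0.
  have near1 : \forall y \near x, y != x -> `|l - q y| <= e.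
    by apply: filterS2 (q_near e e0) nD => y h Dy yx; exact: h.
  have sh : h *: 1 + x @[h --> (0 : R)] --> x.
    rewrite -[X in _ --> X]add0r; apply: cvgD; last exact: cvg_cst.
    under eq_fun do rewrite /GRing.scale /= mulr1.
    exact: cvg_id.
  have near2 : \forall h \near (0 : R), h *: 1 + x != x ->
    `|l - q (h *: 1 + x)| <= e by exact: (sh _ near1).
  suff : \forall h \near (0 : R), h != 0 ->
    `|l - h^-1 *: (f (h *: 1 + x) - f x)| <= e by [].
  apply: filterS near2 => h hh h0.
  have h1 : h *: 1 + x != x by rewrite -subr_eq0 addrK /GRing.scale /= mulr1.
  have := hh h1.
  by rewrite /q addrK {2}/GRing.scale /= mulr1 mulrC.
apply: DeriveDef; first by apply: cvgP H.
exact: cvg_lim H.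
Qed.

End derive_within.

Lemma derivable_within_itv_continuous {R : realType} (D : set R) (f : R -> R)
    (s t : R) : (forall x, D x -> derivable_within D f x) ->
  `[s, t] `<=` D -> {within `[s, t], continuous f}.
Proof.
move=> df sub; apply/subspace_continuousP => x xst.
apply/cvgrPdist_le => e e0.
have := derivable_within_near_continuous D f x (df _ (sub _ xst)) e e0.
by apply: filterS => y h yst; exact/h/sub.
Qed.

Lemma ln2_le1 {R : realType} : ln 2 <= 1 :> R.
Proof. by have := @le_ln1Dx R 1; rewrite -[1 + 1]/(2%:R); apply; lra. Qed.

Section convex_profile.
Context {R : realType} (f : R -> R).
Local Notation f' := (derive_within (log2_ray R) f).
Local Notation f'' := (derive_within (log2_ray R) f').
Hypothesis f_C2 : C2_on (log2_ray R) f.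
Hypothesis f_log2 : f (ln 2) < 1.
Hypothesis f_sign :
  forall t, log2_ray R t -> [/\ 0 < f t, f' t < 0 & 0 < f'' t].
Hypothesis f_lim : f n%:R @[n --> \oo] --> (0 : R).

Lemma log2_rayE (t : R) : log2_ray R t = (ln 2 <= t).
Proof. by rewrite /log2_ray /= in_itv /= andbT. Qed.

Let ray_nbhs (t : R) : ln 2 < t -> nbhs t (log2_ray R).
Proof.
move=> h; near=> s; rewrite log2_rayE; apply/ltW; near: s.
exact: lt_nbhsr.
Unshelve. all: by end_near. Qed.

Let mvt (h : R -> R) (s t : R) :
  (forall x, log2_ray R x -> derivable_within (log2_ray R) h x) ->
  ln 2 <= s -> s < t ->
  exists2 c, s < c < t & h t - h s = derive_within (log2_ray R) h c * (t - s).
Proof.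
move=> dh s2 st.
have [c|c|c] := @MVT R h (derive_within (log2_ray R) h) s t st.
- rewrite in_itv /= => /andP[sc ct].
  have c2 : ln 2 < c by apply: le_lt_trans sc.
  apply: derivable_within_is_derive; last exact: ray_nbhs.
  by apply: dh; rewrite log2_rayE ltW.
- apply: (derivable_within_itv_continuous _ _ _ _ dh) => x /=.
  by rewrite in_itv /= => /andP[sx _]; rewrite log2_rayE (le_trans s2).
- by rewrite in_itv /= => cst e; exists c.
Qed.

Lemma profile_gt0 t : ln 2 <= t -> 0 < f t.
Proof. by rewrite -log2_rayE => /f_sign[]. Qed.

Lemma dprofile_lt0 t : ln 2 <= t -> f' t < 0.
Proof. by rewrite -log2_rayE => /f_sign[]. Qed.

Lemma profile_decr s t : ln 2 <= s -> s < t -> f t < f s.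
Proof.
move=> s2 st; have [df _ _] := f_C2; have [c /andP[sc ct] e] := mvt f s t df s2 st.
rewrite -subr_lt0 e nmulr_rlt0 ?subr_gt0 //; apply: dprofile_lt0.
exact/ltW/(le_lt_trans s2).
Qed.

Lemma profile_anti s t : ln 2 <= s -> s <= t -> f t <= f s.
Proof.
move=> s2; rewrite le_eqVlt => /predU1P[->//|st].
exact/ltW/profile_decr.
Qed.

Lemma dprofile_homo s t : ln 2 <= s -> s <= t -> f' s <= f' t.
Proof.
move=> s2; rewrite le_eqVlt => /predU1P[->//|st].
have [_ df _] := f_C2; have [c /andP[sc ct] e] := mvt _ s t df s2 st.
rewrite -subr_ge0 e mulr_ge0 ?subr_ge0 ?(ltW st) //.
have /f_sign[_ _ /ltW//] : log2_ray R c.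
by rewrite log2_rayE; exact/ltW/(le_lt_trans s2).
Qed.

Lemma profile_slope_le s t : ln 2 <= s -> s <= t ->
  f s - f t <= - f' s * (t - s).
Proof.
move=> s2; rewrite le_eqVlt => /predU1P[->|st]; first by rewrite !subrr mulr0.
have [df _ _] := f_C2; have [c /andP[sc ct] e] := mvt f s t df s2 st.
rewrite -[leLHS]opprB e -mulNr ler_pM2r ?subr_gt0 // lerN2.
exact/dprofile_homo/ltW.
Qed.

Lemma profile_slope_ge s t : ln 2 <= s -> s <= t ->
  - f' t * (t - s) <= f s - f t.
Proof.
move=> s2; rewrite le_eqVlt => /predU1P[->|st]; first by rewrite !subrr mulr0.
have [df _ _] := f_C2; have [c /andP[sc ct] e] := mvt f s t df s2 st.
rewrite -[leRHS]opprB e -mulNr ler_pM2r ?subr_gt0 // lerN2.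
by apply: dprofile_homo; [exact/ltW/(le_lt_trans s2)|exact: ltW].
Qed.

Lemma profile_small e : 0 < e -> exists2 t0, ln 2 <= t0 &
  forall t, t0 <= t -> f t <= e.
Proof.
move=> e0; have := cvgr_le (0 : R) f_lim e e0 => -[n _ hn].
have n2 : ln 2 <= n.+1%:R :> R.
  by apply: le_trans (ln2_le1) _; rewrite ler1n.
exists n.+1%:R => // t nt; apply: le_trans (hn n.+1 _) => //=.
exact: profile_anti.
Qed.

Lemma profile_surj y : 0 < y -> y <= f (ln 2) ->
  exists2 t, ln 2 <= t & f t = y.
Proof.
move=> y0 y2; have [t0 t02 ht0] := profile_small y y0.
have [df _ _] := f_C2.
have [||t] := @IVT R f (ln 2) t0 y t02.
- apply: (derivable_within_itv_continuous _ _ _ _ df) => x /=.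
  by rewrite in_itv /= log2_rayE => /andP[].
- have h := ht0 t0 (lexx _).
  by rewrite ge_min h orbT /= le_max y2.
- by rewrite in_itv /= => /andP[t2 _] e; exists t.
Qed.

Lemma profile_pinvK y : 0 < y -> y <= f (ln 2) ->
  ln 2 <= pinv (log2_ray R) f y /\ f (pinv (log2_ray R) f y) = y.
Proof.
move=> y0 y2; have [t t2 ft] := profile_surj y y0 y2.
have im : (f @` log2_ray R) y by exists t; rewrite ?log2_rayE.
split; last by rewrite pinvK // inE.
rewrite -log2_rayE; apply: (@surjpinv_image_sub _ _ _ (log2_ray R) (f @` log2_ray R) f) => //.
by exists y.
Qed.

(** As f decreases to 0, x tending to 2 from below amounts to t tending to infinity in x = 2 (1 - f
    t); the left neighbourhood is x > 2 (1 - f T). It also guarantees that [pinv] is evaluated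
    inside the range of f. *)
Lemma near2_profile (P : R -> Prop) :
  (exists t0, forall x, 0 < x -> x < 2 ->
     let t := pinv (log2_ray R) f (1 - x / 2) in
     ln 2 <= t -> f t = 1 - x / 2 -> t0 <= t -> P x) ->
  \forall x \near (2 : R)^'-, P x.
Proof.
move=> [t0 hP]; pose T := Num.max t0 (ln 2).
have T2 : ln 2 <= T by rewrite le_max lexx orbT.
have fT : 0 < f T by exact: profile_gt0.
have fT1 : f T < 1 by apply: le_lt_trans f_log2; exact: profile_anti.
near=> x.
have x2 : x < 2 by near: x; exact: nbhs_left_lt.
have xT : 2 * (1 - f T) < x.
  by near: x; apply: nbhs_left_gt; lra.
have x0 : 0 < x by apply: lt_trans xT; rewrite mulr_gt0 // subr_gt0.
have y0 : 0 < 1 - x / 2 by lra.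
have yT : 1 - x / 2 < f T by lra.
have y2 : 1 - x / 2 <= f (ln 2).
  by apply/ltW/(lt_le_trans yT); exact: profile_anti.
have [t2 ft] := profile_pinvK _ y0 y2.
apply: hP => //; apply: (@le_trans _ _ T); first by rewrite le_max lexx.
rewrite leNgt; apply/negP => tT; have := profile_decr _ _ t2 tT.
by rewrite ft; lra.
Unshelve. all: by end_near. Qed.

End convex_profile.

(** * Quadratic bounds for cosh and its inverse *)

Section cosh_bounds.
Context {R : realType}.
Implicit Types t d : R.

(** Mean value theorem for 2 sinh, whose derivative 2 cosh is at least 2. *)
Lemma expR_sub_ge t : 0 <= t -> 2 * t <= expR t - expR (- t).
Proof.
rewrite le_eqVlt => /predU1P[<-|t0]; first by rewrite mulr0 oppr0 subrr.
pose h s : R := expR s - expR (- s).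
have dh (s : R) : is_derive s (1 : R) h (expR s + expR (- s)).
  have d1 : is_derive s (1 : R) (fun s : R => expR (- s)) (- expR (- s)).
    apply: (is_derive_eq (is_derive1_comp (is_derive_expR (- s))
      (is_deriveN (is_derive_id s (1 : R))))).
    by rewrite mulrN1.
  apply: (is_derive_eq (is_deriveB (is_derive_expR s) d1)).
  by rewrite opprK.
have [c _] : exists2 c, c \in `]0, t[%R &
    h t - h 0 = (expR c + expR (- c)) * (t - 0).
  apply: (@MVT R h (fun s => expR s + expR (- s)) 0 t t0).
  apply: continuous_subspaceT => y; apply: differentiable_continuous.
  by apply/derivable1_diffP; have [] := dh y.
rewrite /h oppr0 subrr addr0 subr0 => ->; rewrite ler_pM2r //.
  have e1 : expR c * expR (- c) = 1 by rewrite -expRD subrr expR0.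
  have e2 := expR_gt0 c; have := sqr_ge0 (expR c - expR (- c)).
  have e3 := expR_gt0 (- c); nra.
Qed.

Let cosh_half t : cosh t - 1 = (expR (t / 2) - expR (- (t / 2))) ^+ 2 / 2.
Proof.
have e (s : R) : expR s = expR (s / 2) * expR (s / 2) by rewrite -expRD -splitr.
have e1 : expR (t / 2) * expR (- (t / 2)) = 1 by rewrite -expRD subrr expR0.
rewrite /cosh (e t) (e (- t)) mulNr sqrrB -!expr2 e1.
by field.
Qed.

Lemma cosh_ge t : 0 <= t -> t ^+ 2 / 2 <= cosh t - 1.
Proof.
move=> t0; rewrite cosh_half ler_pM2r //.
have h := expR_sub_ge (t / 2) _.
apply: lerXn2r; rewrite ?nnegrE //; lra.
Qed.

(** By the half-angle formula it is enough that exp (t/2) - exp (-t/2) = exp (t/2) (1 - exp (-t)) is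
    at most t exp (t/2). *)
Lemma cosh_le t : 0 <= t -> cosh t - 1 <= t ^+ 2 / 2 * expR t.
Proof.
move=> t0; rewrite cosh_half [leRHS]mulrAC ler_pM2r //.
have e : expR t = expR (t / 2) ^+ 2 by rewrite expr2 -expRD -splitr.
rewrite e -exprMn; apply: lerXn2r; rewrite ?nnegrE ?mulr_ge0 ?expR_ge0 //.
  by rewrite subr_ge0 ler_expR; lra.
have h := expR_ge1Dx (- t).
have e2 : expR (- (t / 2)) = expR (t / 2) * expR (- t).
  by rewrite -expRD; congr expR; field.
rewrite e2; have := expR_gt0 (t / 2); nra.
Qed.

Lemma cosh_onto (y : R) : 1 <= y -> exists2 t, 0 <= t & y = cosh t.
Proof.
move=> y1; pose r := Num.sqrt (y ^+ 2 - 1).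
have rr : r ^+ 2 = y ^+ 2 - 1 by rewrite sqr_sqrtr // subr_ge0 expr_ge1 //; lra.
have r0 : 0 <= r by exact: sqrtr_ge0.
have yr : 0 < y + r by lra.
exists (ln (y + r)); first by apply: ln_ge0; lra.
rewrite /cosh expRN lnK ?posrE //.
have -> : (y + r)^-1 = y - r.
  apply: (mulfI (lt0r_neq0 yr)); rewrite divff ?gt_eqF //.
  have -> : (y + r) * (y - r) = y ^+ 2 - r ^+ 2 by ring.
  by rewrite rr; ring.
by field.
Qed.

Lemma cosh_arg_le t d : 0 <= t -> cosh t = 1 + d -> t <= Num.sqrt (2 * d).
Proof.
move=> t0 e; have h := cosh_ge t t0; have h0 := sqr_ge0 t.
rewrite -[leLHS]ger0_norm // -sqrtr_sqr ler_sqrt ?sqr_ge0 //; lra.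
Qed.

(** With s = sqrt (2 d), [cosh_le] gives s <= t exp (t/2), so t >= s exp (-t/2) >= s (1 - t/2), and
    t <= s. *)
Lemma cosh_arg_ge t d : 0 <= t -> cosh t = 1 + d ->
  Num.sqrt (2 * d) * (1 - Num.sqrt (2 * d) / 2) <= t.
Proof.
move=> t0 e; have h1 := cosh_arg_le t d t0 e; have h2 := cosh_le t t0.
set s := Num.sqrt (2 * d) in h1 *.
have s0 : 0 <= s by exact: sqrtr_ge0.
have h3 : s <= t * expR (t / 2).
  rewrite -[leRHS]ger0_norm ?mulr_ge0 ?expR_ge0 // -sqrtr_sqr ler_sqrt ?sqr_ge0 //.
  have e2 : expR (t / 2) ^+ 2 = expR t by rewrite expr2 -expRD -splitr.
  rewrite exprMn e2; lra.
apply: (@le_trans _ _ (s * expR (- (t / 2)))).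
  apply: ler_wpM2l => //; have := expR_ge1Dx (- (t / 2)); lra.
have := ler_wpM2r (expR_ge0 (- (t / 2))) h3.
by rewrite -mulrA -expRD subrr expR0 mulr1.
Qed.

(** In the hyperbolic range the defining set of [gamma_] is inhabited, so [get] returns one of its
    elements and not a default. *)
Lemma gamma_P (a : nat -> R) j x : 0 < a j -> 2 * a j <= x ->
  0 <= gamma_ a j x /\ x / a j = 2 * cosh (gamma_ a j x).
Proof.
move=> a0 ax; have h : 1 <= x / a j / 2.
  by rewrite ler_pdivlMr // mul1r ler_pdivlMr //.
have [t t0 e] := cosh_onto _ h.
apply: (@getPex _ [set t : R | 0 <= t /\ x / a j = 2 * cosh t]).
by exists t; split => //; rewrite -e [RHS]mulrC divfK.
Qed.

End cosh_bounds.

(** * Asymptotics of the sum of the gamma_j *)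

Section log_sum.
Context {R : realType}.
Local Notation leb := (@lebesgue_measure R).

Lemma count_le (y : R) n : 0 <= y ->
  \sum_(1 <= k < n.+1) ((k%:R <= y :> R)%:R : R) <= y.
Proof.
move=> y0.
suff : \sum_(1 <= k < n.+1) ((k%:R <= y :> R)%:R : R) <= y /\
       \sum_(1 <= k < n.+1) ((k%:R <= y :> R)%:R : R) <= n%:R by case.
elim: n => [|n [IH1 IH2]]; first by rewrite big_geq.
rewrite big_nat_recr //= -natr1.
case: (leP (n%:R + 1) y) => h /=; last first.
  by rewrite mulr0n addr0; split=> //; rewrite (le_trans IH2) // lerDl.
by split; lra.
Qed.

(** Either the count has already reached y - 1, or every k up to n has been counted; in the latter
    case y < n + 1 concludes. *)
Lemma count_ge (y : R) n : y < n.+1%:R ->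
  y - 1 <= \sum_(1 <= k < n.+1) ((k%:R <= y :> R)%:R : R).
Proof.
set S := \sum_(1 <= k < n.+1) _.
suff : y - 1 <= S \/ n%:R <= S by rewrite -natr1 => -[|h1 h2]; lra.
rewrite {}/S; elim: n => [|n IHn]; first by right; rewrite big_geq.
rewrite big_nat_recr //= -natr1.
case: (leP (n%:R + 1) y) => h /=; last first.
  by left; rewrite mulr0n addr0; case: IHn => ?; lra.
by case: IHn => ?; [left|right]; lra.
Qed.

Definition log_sum (M : R) : R :=
  \sum_(1 <= k < (Num.truncn M).+1) Num.sqrt (ln (M / k%:R)).

Definition layer (M t : R) : R :=
  \sum_(1 <= k < (Num.truncn M).+1) ((k%:R <= M * gauss_fun t :> R)%:R : R).

Lemma layer_ge0 M t : 0 <= layer M t.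
Proof. by apply: sumr_ge0 => k _; rewrite ler0n. Qed.

Let ind (s : R) : R -> R := \1_(`[0, s]%classic : set R).

Lemma le_sqrt_ln (M t : R) k : 0 < M -> (0 < k)%N -> (k <= Num.truncn M)%N ->
  0 <= t -> (t <= Num.sqrt (ln (M / k%:R))) = (k%:R <= M * gauss_fun t).
Proof.
move=> M0 k0 kM t0; have kp : 0 < k%:R :> R by rewrite ltr0n.
have Mk : 1 <= M / k%:R.
  rewrite ler_pdivlMr // mul1r; have /andP[h _] := truncn_itv (ltW M0); apply: le_trans h.
  by rewrite ler_nat.
have L0 : 0 <= ln (M / k%:R) by exact: ln_ge0.
rewrite -{1}(ger0_norm t0) -sqrtr_sqr ler_sqrt //.
rewrite -ler_expR lnK ?posrE ?(lt_le_trans _ Mk) //.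
rewrite /gauss_fun expRN ler_pdivlMr // mulrC -ler_pdivlMr ?expR_gt0 //.
Qed.

Let itv0_length (s : R) : 0 <= s -> leb (`[0, s]%classic : set R) = s%:E.
Proof.
move=> s0; rewrite lebesgue_measure_itv /= lte_fin.
case: ltP => h; first by rewrite oppr0 adde0.
by congr EFin; apply/eqP; rewrite eq_le h s0.
Qed.

(* Layer cake: t <= sqrt (ln (M / k)) if and only if k <= M exp (- t^2), so that
   summing over k gives the integral of a counting function. *)
Lemma log_sum_integral (M : R) : 0 < M ->
  ((log_sum M)%:E = \int[leb]_(t in `[0%R, +oo[) (layer M t)%:E)%E.
Proof.
move=> M0; rewrite /log_sum -sumEFin.
transitivity (\sum_(1 <= k < (Num.truncn M).+1)
   \int[leb]_(t in `[0%R, +oo[) (ind (Num.sqrt (ln (M / k%:R))) t)%:E)%E.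
  apply: eq_bigr => k _; rewrite integral_indic //.
  rewrite setIidl; last first.
    by move=> t /=; rewrite !in_itv /= andbT => /andP[].
  by rewrite -[LHS]itv0_length // sqrtr_ge0.
rewrite -ge0_integral_sum //.
- apply: eq_integral => t; rewrite inE /= ?in_itv /= andbT => t0.
  rewrite /layer sumEFin; congr EFin.
  rewrite big_nat [RHS]big_nat; apply: eq_bigr => k /andP[k0 kM].
  rewrite -(le_sqrt_ln M t k M0 k0) // /ind indicE mem_setE in_itv /=.
  by rewrite t0.
- move=> k; apply/measurable_EFinP; apply: measurable_funTS.
  exact: measurable_indic.
- by move=> k t _; rewrite lee_fin.
Qed.

Let measurable_layer M (D : set (measurableTypeR R)) :
  measurable_fun D (layer M : measurableTypeR R -> R).
Proof.
apply: measurable_funTS; apply: measurable_sum => k.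
rewrite (_ : (fun x : R => _) = \1_[set x : R | k%:R <= M * gauss_fun x]).
  apply: measurable_indic.
  rewrite -[X in measurable X]setTI.
  apply: (measurable_fun_le (f := cst k%:R)) => //.
  by apply: measurable_funM => //; exact: measurable_gauss_fun.
by apply/funext => x; rewrite indicE; congr (nat_of_bool _)%:R; apply/idP/idP; rewrite inE.
Qed.

Let layer_le M t : 0 <= M -> layer M t <= M * gauss_fun t.
Proof. by move=> M0; apply: count_le; rewrite mulr_ge0 // gauss_fun_ge0. Qed.

Let layer_ge M t : 0 <= M -> M * gauss_fun t <= layer M t + 1.
Proof.
move=> M0; rewrite -lerBlDr; apply: count_ge.
apply: (@le_lt_trans _ _ M); last exact: truncnS_gt.
by rewrite ler_piMr // gauss_fun_le1.
Qed.

Let integral_gaussZ (M : R) (D : set (measurableTypeR R)) : measurable D ->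
  0 <= M -> (\int[leb]_(t in D) (M%:E * (gauss_fun t)%:E) =
             M%:E * \int[leb]_(t in D) (gauss_fun t)%:E)%E.
Proof.
move=> mD M0; apply: ge0_integralZl => //.
- apply/measurable_EFinP/(measurable_funS measurableT) => //.
  exact: measurable_gauss_fun.
- by move=> t _; rewrite lee_fin gauss_fun_ge0.
Qed.

Lemma log_sum_le (M : R) : 0 < M -> log_sum M <= M * (Num.sqrt pi / 2).
Proof.
move=> M0; rewrite -lee_fin log_sum_integral //.
rewrite EFinM -integral0y_gauss -integral_gaussZ ?(ltW M0) //.
apply: ge0_le_integral => //.
- by move=> t _; rewrite lee_fin layer_ge0.
- by apply/measurable_EFinP; exact: measurable_layer.
- apply/measurable_EFinP/measurable_funTS; apply: measurable_funM => //.
  exact: measurable_gauss_fun.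
- by move=> t _; rewrite -EFinM lee_fin layer_le // ltW.
Qed.

(** A count differs from its real bound by at most 1, an error that is not integrable on the
    half-line. The integral is cut at an n beyond which the Gaussian has mass less than e, and the
    error then costs C = n. *)
Lemma log_sum_ge (e : R) : 0 < e -> exists2 C, 0 <= C &
  forall M, 0 < M -> M * (Num.sqrt pi / 2 - e) - C <= log_sum M.
Proof.
move=> e0.
have := @ge0_cvgn_integral R leb _ (@gauss_fun_ge0 R) (@measurable_gauss_fun R).
rewrite integral0y_gauss => /fine_cvgP[fin cvg].
have [n _ hn] : \forall n \near \oo,
  (\int[leb]_(x in `[0%R, n%:R]) (gauss_fun x)%:E)%E \is a fin_num /\
  Num.sqrt pi / 2 - e < fine (\int[leb]_(x in `[0%R, n%:R]) (gauss_fun x)%:E)%E.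
  apply: filterS2 fin (cvgr_gt _ cvg (Num.sqrt pi / 2 - e) _) => //.
  by rewrite ltrBlDr ltrDl.
have [hfin hgt] := hn n (leqnn n).
exists n%:R => // M M0.
rewrite lerBlDr -lee_fin EFinD log_sum_integral //.
apply: (@le_trans _ _ (M%:E * \int[leb]_(x in `[0%R, n%:R]) (gauss_fun x)%:E)%E).
  by rewrite -(fineK hfin) -EFinM lee_fin ler_pM2l // ltW.
rewrite -integral_gaussZ ?(ltW M0) //.
apply: (@le_trans _ _ (\int[leb]_(x in `[0%R, n%:R]) ((layer M x)%:E + 1))%E).
  apply: ge0_le_integral => //.
  - by move=> t _; rewrite -EFinM lee_fin mulr_ge0 ?gauss_fun_ge0 // ltW.
  - apply/measurable_EFinP/measurable_funTS; apply: measurable_funM => //.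
    exact: measurable_gauss_fun.
  - apply: emeasurable_funD => //.
    by apply/measurable_EFinP; exact: measurable_layer.
  - by move=> t _; rewrite -EFinM -EFinD lee_fin layer_ge // ltW.
rewrite ge0_integralD //; last 2 first.
- by move=> t _; rewrite lee_fin layer_ge0.
- by apply/measurable_EFinP; exact: measurable_layer.
apply: leeD.
  apply: ge0_subset_integral => //.
  - by apply/measurable_EFinP; exact: measurable_layer.
  - by move=> t _; rewrite lee_fin layer_ge0.
  - by move=> t /=; rewrite !in_itv /= andbT => /andP[].
by rewrite integral_cst // mul1e -(itv0_length n%:R).
Qed.

End log_sum.

(** * From the sum of the gamma_j to the Gaussian constant *)

Section profile_sum.
Context {R : realType} (f : R -> R).
Local Notation f' := (derive_within (log2_ray R) f).
Local Notation f'' := (derive_within (log2_ray R) f').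
Hypothesis f_C2 : C2_on (log2_ray R) f.
Hypothesis f_log2 : f (ln 2) < 1.
Hypothesis f_sign :
  forall t, log2_ray R t -> [/\ 0 < f t, f' t < 0 & 0 < f'' t].
Hypothesis f_lim : f n%:R @[n --> \oo] --> (0 : R).
Hypothesis f'_slow : forall eps : R, 0 < eps ->
  N%:R `^ eps * Num.sqrt (- f' (ln N%:R)) @[N --> \oo] --> +oo.
Hypothesis f'_regular :
  limn_esup (fun k : nat =>
    ((- f' ((1 - eps) * k%:R)) / (- f' k%:R))%:E) @[eps --> (0 : R)^'+]
  --> (1%E : \bar R).

Let f_gt0 t : ln 2 <= t -> 0 < f t.
Proof. exact: (profile_gt0 f f_sign). Qed.
Let df_gt0 t : ln 2 <= t -> 0 < - f' t.
Proof. by rewrite oppr_gt0; exact: (dprofile_lt0 f f_sign). Qed.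
Let f_anti s t : ln 2 <= s -> s <= t -> f t <= f s.
Proof. exact: (profile_anti f f_C2 f_sign). Qed.
Let df_anti s t : ln 2 <= s -> s <= t -> - f' t <= - f' s.
Proof. by rewrite lerN2; exact: (dprofile_homo f f_C2 f_sign). Qed.
Let slope_le s t : ln 2 <= s -> s <= t -> f s - f t <= - f' s * (t - s).
Proof. exact: (profile_slope_le f f_C2 f_sign). Qed.
Let slope_ge s t : ln 2 <= s -> s <= t -> - f' t * (t - s) <= f s - f t.
Proof. exact: (profile_slope_ge f f_C2 f_sign). Qed.

(** For n = [exp t] + 1, ln n lies between t and t + ln 2. Since - f' decreases, passing from n to t
    costs only the factor 2^eps, which is built into [C']. *)
Lemma dprofile_slow (eps C : R) : 0 < eps -> exists t0, forall t, t0 <= t ->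
  C <= expR (eps * t) * Num.sqrt (- f' t).
Proof.
move=> e0; pose C' := expR (eps * ln 2) * `|C|.
have /cvgryPge/(_ C')[n0 _ hn0] := f'_slow eps e0.
exists (Num.max (ln 2) n0%:R) => t; rewrite ge_max => /andP[t2 tn].
pose n := (Num.truncn (expR t)).+1.
have tn1 : expR t < n%:R by exact: truncnS_gt.
have n0n : (n0 <= n)%N.
  rewrite -(ler_nat R); apply: le_trans (ltW tn1); apply: (le_trans tn).
  by apply: le_trans (expR_ge1Dx t); rewrite lerDr.
have np : 0 < n%:R :> R by rewrite ltr0n.
have t_ln : t <= ln n%:R by rewrite -ler_expR lnK ?posrE // ltW.
have ln_t : ln n%:R <= ln 2 + t.
  rewrite -[t in leRHS]expRK -lnM ?posrE ?expR_gt0 //.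
  rewrite ler_ln ?posrE ?mulr_gt0 ?expR_gt0 //.
  have /andP[h _] := truncn_itv (expR_ge0 t).
  have h1 : 1 <= expR t.
    by rewrite -(expR0 R) ler_expR (le_trans _ t2) // ln_ge0 // ler1n.
  by rewrite /n -natr1; lra.
have := hn0 n n0n; rewrite /= => h.
have h1 : n%:R `^ eps <= expR (eps * ln 2) * expR (eps * t).
  by rewrite /powR gt_eqF // -expRD ler_expR -mulrDr ler_pM2l.
have h2 : Num.sqrt (- f' (ln n%:R)) <= Num.sqrt (- f' t).
  by rewrite ler_sqrt ?(ltW (df_gt0 t t2)) //; exact: df_anti.
have h3 : C' <= expR (eps * ln 2) * (expR (eps * t) * Num.sqrt (- f' t)).
  apply: (le_trans h); rewrite mulrA.
  by apply: ler_pM; rewrite ?powR_ge0 ?sqrtr_ge0.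
apply: (le_trans (ler_norm C)).
by rewrite -(ler_pM2l (expR_gt0 (eps * ln 2))).
Qed.

(** The limsup gives the bound with [e0] at large integers. For k = [t] + 1, half of [e0] pays for
    the rounding: (1 - e0) (t + 1) <= (1 - e0/2) t as soon as t e0 >= 2. *)
Lemma dprofile_regular (eta : R) : 0 < eta -> exists2 eps, 0 < eps < 1 &
  exists t0, forall t, t0 <= t -> - f' ((1 - eps) * t) <= (1 + eta) * - f' t.
Proof.
move=> eta0.
have lt1 : (1%E < (1 + eta)%:E :> \bar R)%E by rewrite lte_fin ltrDl.
have near1 := f'_regular _ (open_ereal_lt' lt1).
have [e0 /andP[e00 e01] he0] : exists2 e0 : R, 0 < e0 < 1 &
   (limn_esup (fun k : nat =>
    ((- f' ((1 - e0) * k%:R)) / (- f' k%:R))%:E) < (1 + eta)%:E)%E.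
  have near2 : \forall e \near (0 : R)^'+, 0 < e < 1.
    by near=> e; apply/andP; split; near: e;
      [exact: nbhs_right_gt|exact: nbhs_right_lt].
  have [e [h1 h2]] := @filter_ex _ (0 : R)^'+ _ _ (filterI near2 near1).
  by exists e.
set u := (fun k : nat => _) in he0.
have cu : esups u @ \oo --> limn_esup u.
  by rewrite limn_esup_lim; exact: is_cvg_esups.
have [n0 _ hn0] := cu _ (open_ereal_lt' he0).
have hu n : (n0 <= n)%N -> (u n < (1 + eta)%:E)%E.
  move=> n0n; apply: le_lt_trans (hn0 n n0n) => /=.
  by apply: ereal_sup_ubound; exists n => /=.
exists (e0 / 2); first by apply/andP; split; lra.
exists (Num.max (n0%:R + 2 / e0) (ln 2 / (1 - e0))) => t.
rewrite ge_max => /andP[ht1 ht2].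
have e0i : 0 < 2 / e0 by rewrite divr_gt0.
have n0p : 0 <= n0%:R :> R by rewrite ler0n.
have t0 : 0 < t by lra.
have te : 2 <= t * e0 by rewrite -ler_pdivrMr //; lra.
pose k := (Num.truncn t).+1.
have tk : t < k%:R by exact: truncnS_gt.
have kt : k%:R <= t + 1.
  by have /andP[h _] := truncn_itv (ltW t0); rewrite /k -natr1 lerD2r.
have n0k : (n0 <= k)%N by rewrite -(ler_nat R); lra.
have e1 : 0 < 1 - e0 by rewrite subr_gt0.
have k2 : ln 2 <= (1 - e0) * k%:R.
  move: ht2; rewrite ler_pdivrMr // => ht2; apply: (le_trans ht2).
  by rewrite mulrC ler_pM2l // ltW.
have t2 : ln 2 <= t.
  apply: le_trans ht2; rewrite ler_pdivlMr // ler_piMr ?ln_ge0 ?ler1n //.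
  by rewrite gerBl ltW.
have hk := hu k n0k; move: hk; rewrite /u lte_fin ltr_pdivrMr; last first.
  by apply: df_gt0; apply: le_trans t2 (ltW tk).
move=> /ltW hk; apply: (@le_trans _ _ (- f' ((1 - e0) * k%:R))).
  apply: df_anti => //.
  apply: (@le_trans _ _ ((1 - e0) * (t + 1))); first by rewrite ler_pM2l.
  nra.
apply: (le_trans hk); apply: ler_wpM2l; first by lra.
exact: df_anti (ltW tk).
Unshelve. all: by end_near. Qed.


(** The function g in the variable t, at x = 2 (1 - f t); the range is j <= N because N + 1 =
    [exp t]. *)
Definition gamma_sum (t : R) : R :=
  \sum_(1 <= j < Num.truncn (expR t)) gamma_ (a_ f) j (2 * (1 - f t)).

Let a1 := 1 - f (ln 2).
Let a1_gt0 : 0 < a1. Proof. by rewrite subr_gt0. Qed.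
Let cst := Num.sqrt (pi / 2) : R.

Let cst_ge1 : 1 <= cst.
Proof. by rewrite -sqrtr1 ler_sqrt ?divr_ge0 ?pi_ge0 //; have := pi_ge2 R; lra. Qed.

(** Origin of sqrt (pi/2): the factor sqrt 2 comes from inverting cosh near 1, and sqrt pi / 2 is
    the Gaussian integral over the half-line. *)
Let cstE u : 0 <= u ->
  Num.sqrt (2 * u) * (Num.sqrt pi / 2) = cst * Num.sqrt u.
Proof.
move=> u0; rewrite sqrtrM // mulrAC; congr (_ * _).
rewrite /cst; apply/eqP; rewrite -(eqrXn2 (n := 2)) ?mulr_ge0 ?sqrtr_ge0 //.
by rewrite 2!exprMn !sqr_sqrtr ?divr_ge0 ?pi_ge0 //; apply/eqP; field.
Qed.

Let ln_nat_ge (j : nat) : (0 < j)%N -> ln 2 <= ln j.+1%:R :> R.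
Proof. by move=> j0; rewrite ler_ln ?posrE ?ltr0n // ler_nat. Qed.

Let ln_nat_le (t : R) (j : nat) : (j < Num.truncn (expR t))%N -> ln j.+1%:R <= t.
Proof.
move=> jt; rewrite -[leRHS]expRK ler_ln ?posrE ?ltr0n ?expR_gt0 //.
by rewrite -truncn_ge_nat ?expR_ge0.
Qed.

Let excess (t : R) (j : nat) := (f (ln j.+1%:R) - f t) / a_ f j.

Let gamma_spec (t : R) j : ln 2 <= t -> (0 < j)%N -> ln j.+1%:R <= t ->
  let g := gamma_ (a_ f) j (2 * (1 - f t)) in
  [/\ a1 <= a_ f j, 0 <= g & cosh g = 1 + excess t j].
Proof.
move=> t2 j0 jt; have j2 := ln_nat_ge _ j0.
have aj : a1 <= a_ f j by rewrite /a1 /a_ lerD2l lerN2; exact: f_anti.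
have aj0 : 0 < a_ f j by exact: lt_le_trans aj.
have [|g0 e] := gamma_P (a_ f) j (2 * (1 - f t)) aj0.
  by rewrite ler_pM2l // /a_ lerD2l lerN2; exact: f_anti.
split => //; apply: (mulfI (_ : 2 != 0 :> R)); rewrite ?pnatr_eq0 // -e.
by rewrite /excess /a_ in aj0 *; field; rewrite gt_eqF.
Qed.

Let sqrt_ln_div (t : R) j : ln j.+1%:R <= t ->
  ln (expR t / j.+1%:R) = t - ln j.+1%:R.
Proof.
by move=> jt; rewrite ln_div ?posrE ?expR_gt0 ?ltr0n // expRK.
Qed.

(** As a_j involves ln (j + 1), gamma_j is matched with the term k = j + 1 of [log_sum]; the
    unmatched term k = 1 is sqrt t. *)
Let log_sum_tail (t : R) : 0 <= t ->
  log_sum (expR t) = Num.sqrt t +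
   \sum_(1 <= j < Num.truncn (expR t)) Num.sqrt (ln (expR t / j.+1%:R)).
Proof.
move=> t0; rewrite /log_sum big_ltn; last first.
  by rewrite ltnS truncn_ge_nat ?expR_ge0 // -(expR0 R) ler_expR.
by rewrite divr1 expRK big_add1.
Qed.

Let count_tail (y : R) n : 0 <= y ->
  \sum_(1 <= j < n) ((ln j.+1%:R < y :> R)%:R : R) <= expR y.
Proof.
move=> y0; apply: (@le_trans _ _ (\sum_(1 <= k < n.+1) ((k%:R <= expR y :> R)%:R : R))).
  case: n => [|n]; first by rewrite !big_geq.
  rewrite [leRHS]big_ltn // big_add1 /=.
  apply: (@le_trans _ _ (\sum_(1 <= j < n.+1) ((j.+1%:R <= expR y :> R)%:R : R))).
    apply: ler_sum => j _; rewrite ler_nat.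
    case: ltP => //= h; rewrite -[X in (X <= _)%R]lnK ?posrE ?ltr0n //.
    by rewrite ler_expR ltW.
  by rewrite lerDr.
exact/count_le/expR_ge0.
Qed.

(* The terms with ln (j + 1) < (1 - eps) t contribute at most C exp ((1 - eps) t),
   which is negligible by dprofile_slow. *)
Lemma gamma_sum_le (eta : R) : 0 < eta -> exists t0, forall t, t0 <= t ->
  gamma_sum t <= ((1 + eta) * cst + eta) * (expR t * Num.sqrt (- f' t)).
Proof.
move=> eta0; have [eps /andP[e0 e1] [t1 ht1]] := dprofile_regular eta eta0.
have eta1 : 0 < 1 + eta by rewrite addr_gt0.
(* f <= eta / (1 + eta) is what yields 1 / a_j <= 1 + eta. The constant [C] below is the crude bound
   for gamma_j that follows from excess <= 1 / a_1. *)
have [t2 t22 ht2] := profile_small f f_C2 f_sign f_lim (eta / (1 + eta))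
  (divr_gt0 eta0 eta1).
pose C := Num.sqrt (2 * a1^-1); have C0 : 0 <= C by exact: sqrtr_ge0.
have [t3 ht3] := dprofile_slow eps (C / eta) e0.
have e1' : 0 < 1 - eps by rewrite subr_gt0.
exists (Num.max (Num.max t1 t3) (t2 / (1 - eps))) => t.
rewrite !ge_max => /andP[/andP[tt1 tt3]]; rewrite ler_pdivrMr // mulrC => tt2.
set s := (1 - eps) * t in tt2.
have ln20 : 0 <= ln 2 :> R by rewrite ln_ge0 // ler1n.
have s2 : ln 2 <= s by exact: le_trans tt2.
have t0 : 0 < t.
  have : 0 < s by apply: lt_le_trans s2; rewrite ln_gt0 // ltr1n.
  by rewrite /s pmulr_rgt0.
have st : s <= t by rewrite /s ler_piMl ?(ltW t0) // gerBl (ltW e0).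
have tln2 : ln 2 <= t by exact: le_trans st.
set u := - f' t; have u0 : 0 < u by exact: df_gt0.
have bound j : (0 < j)%N -> (j < Num.truncn (expR t))%N ->
    gamma_ (a_ f) j (2 * (1 - f t)) <=
    (1 + eta) * Num.sqrt (2 * u) * Num.sqrt (ln (expR t / j.+1%:R)) +
    C * (ln j.+1%:R < s :> R)%:R.
  move=> j0 jn; have jt := ln_nat_le _ _ jn.
  have [aj g0 e] := gamma_spec t j tln2 j0 jt.
  have j2 := ln_nat_ge _ j0.
  have aj0 : 0 < a_ f j by exact: lt_le_trans aj.
  have main0 : 0 <= (1 + eta) * Num.sqrt (2 * u) * Num.sqrt (ln (expR t / j.+1%:R)).
    by rewrite !mulr_ge0 ?sqrtr_ge0 ?(ltW eta1).
  apply: (le_trans (cosh_arg_le _ _ g0 e)).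
  case: ltP => sj.
    rewrite mulr1 -[leLHS]add0r; apply: lerD => //.
    rewrite /C ler_sqrt ?mulr_ge0 ?invr_ge0 ?(ltW a1_gt0) // ler_pM2l //.
    rewrite /excess ler_pdivrMr //.
    apply: (@le_trans _ _ 1).
      have h1 : f (ln j.+1%:R) <= f (ln 2) by exact: f_anti.
      have h2 := f_gt0 _ tln2; rewrite lerBlDr.
      by apply: (le_trans h1); apply: (le_trans (ltW f_log2)); rewrite lerDl ltW.
    by rewrite mulrC ler_pdivlMr // mul1r.
  rewrite mulr0 addr0 sqrt_ln_div //.
  have -> : (1 + eta) * Num.sqrt (2 * u) * Num.sqrt (t - ln j.+1%:R) =
      Num.sqrt ((1 + eta) ^+ 2 * (2 * u) * (t - ln j.+1%:R)).
    have h0 : 0 <= (1 + eta) ^+ 2 * (2 * u).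
      by rewrite !mulr_ge0 ?(ltW eta1) ?(ltW u0).
    rewrite [RHS]sqrtrM //.
    by rewrite [in RHS]sqrtrM ?exprn_ge0 ?(ltW eta1) // sqrtr_sqr ger0_norm // ltW.
  rewrite ler_sqrt; last first.
    by rewrite !mulr_ge0 ?exprn_ge0 ?(ltW eta1) ?(ltW u0) // subr_ge0.
  have h1 : f (ln j.+1%:R) - f t <= (1 + eta) * u * (t - ln j.+1%:R).
    apply: (le_trans (slope_le _ _ j2 jt)); apply: ler_wpM2r; first by rewrite subr_ge0.
    apply: le_trans (ht1 t tt1); exact: df_anti.
  have h2 : (a_ f j)^-1 <= 1 + eta.
    rewrite -[leLHS]mul1r ler_pdivrMr // /a_.
    have := ht2 _ (le_trans tt2 sj); rewrite ler_pdivlMr // => h3.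
    nra.
  rewrite [leRHS](_ : _ = 2 * ((1 + eta) * u * (t - ln j.+1%:R) * (1 + eta))); last by ring.
  rewrite ler_pM2l // /excess; apply: ler_pM => //.
  - by rewrite subr_ge0; exact: f_anti.
  - by rewrite invr_ge0 ltW.
apply: (@le_trans _ _ (\sum_(1 <= j < Num.truncn (expR t))
  ((1 + eta) * Num.sqrt (2 * u) * Num.sqrt (ln (expR t / j.+1%:R)) +
    C * (ln j.+1%:R < s :> R)%:R))).
  rewrite /gamma_sum big_nat [leRHS]big_nat; apply: ler_sum => j /andP[j0 jn].
  exact: bound.
rewrite big_split /= -!mulr_sumr [leRHS]mulrDl; apply: lerD.
  rewrite mulrACA -mulrA [leRHS](_ : _ =
    (1 + eta) * (Num.sqrt (2 * u) * (expR t * (Num.sqrt pi / 2)))); last first.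
    by rewrite [Num.sqrt (2 * u) * _]mulrCA cstE ?(ltW u0) //; ring.
  apply: ler_wpM2l; first exact: ltW.
  apply: ler_wpM2l; first exact: sqrtr_ge0.
  apply: le_trans (log_sum_le _ (expR_gt0 t)).
  by rewrite log_sum_tail ?(ltW t0) // lerDr sqrtr_ge0.
apply: (@le_trans _ _ (C * expR s)).
  apply: ler_wpM2l => //; apply: count_tail.
  exact: le_trans s2.
have := ht3 t tt3; rewrite -/u ler_pdivrMr // => h.
have es : expR s * expR (eps * t) = expR t.
  by rewrite -expRD /s; congr expR; ring.
rewrite -es; have := expR_gt0 s => hs.
rewrite mulrC [leRHS](_ : _ = expR s * (expR (eps * t) * Num.sqrt u * eta)); last by ring.
by rewrite ler_pM2l.
Qed.

(** Convexity gives f (ln (j+1)) - f t >= - f' t (t - ln (j+1)), and dividing by a_j < 1 only helps.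
    The correction in [cosh_arg_ge] is at most eta once f (ln (j+1)) <= 2 eta^2 a_1. This may fail
    for at most exp t2 indices, where gamma_j is bounded below by 0 at a cost of sqrt t each. *)
Lemma gamma_sum_ge (eta : R) : 0 < eta -> eta < 1 -> exists t0, forall t, t0 <= t ->
  (1 - eta) * (cst - 4 * eta) * (expR t * Num.sqrt (- f' t)) <= gamma_sum t.
Proof.
move=> eta0 eta1; have eta2 : 0 < 2 * eta ^+ 2 * a1.
  by rewrite !mulr_gt0 // exprn_gt0.
have [t2 t22 ht2] := profile_small f f_C2 f_sign f_lim _ eta2.
have [C0 C00 hC0] := @log_sum_ge R eta eta0.
(* [K t] dominates all additive losses: [C0] from [log_sum_ge], the exceptional indices, and the
   unmatched term sqrt t. With exp t >= t^2/4, the threshold 4 K / eta makes it at most eta exp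
   t. *)
pose K := C0 + expR t2 + 1.
have K0 : 0 < K by have := expR_gt0 t2; rewrite /K; lra.
have ln20 : 0 <= ln 2 :> R by rewrite ln_ge0 // ler1n.
exists (Num.max t2 (Num.max 1 (4 * K / eta))) => t.
rewrite !ge_max => /andP[tt2 /andP[tt1 tt3]].
have tln2 : ln 2 <= t by exact: le_trans tt2.
have t0 : 0 < t by lra.
set u := - f' t; have u0 : 0 < u by exact: df_gt0.
set s2u := Num.sqrt (2 * u); have s2u0 : 0 <= s2u by exact: sqrtr_ge0.
have st0 : 0 <= Num.sqrt t by exact: sqrtr_ge0.
have eta1' : 0 <= 1 - eta by rewrite subr_ge0 ltW.
have bound j : (0 < j)%N -> (j < Num.truncn (expR t))%N ->
    (1 - eta) * s2u * (Num.sqrt (ln (expR t / j.+1%:R))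
      - Num.sqrt t * (ln j.+1%:R < t2 :> R)%:R) <=
    gamma_ (a_ f) j (2 * (1 - f t)).
  move=> j0 jn; have jt := ln_nat_le _ _ jn.
  have [aj g0 e] := gamma_spec t j tln2 j0 jt.
  have j2 := ln_nat_ge _ j0.
  have aj0 : 0 < a_ f j by exact: lt_le_trans aj.
  rewrite sqrt_ln_div //; case: ltP => sj.
    apply: le_trans g0; rewrite mulr1 mulr_ge0_le0 ?mulr_ge0 // subr_le0.
    rewrite ler_sqrt ?(ltW t0) // gerBl.
    by apply: le_trans j2.
  rewrite mulr0 subr0; apply: le_trans (cosh_arg_ge _ _ g0 e).
  have ex0 : 0 <= excess t j.
    by rewrite divr_ge0 ?(ltW aj0) // subr_ge0; exact: f_anti.
  have h1 : u * (t - ln j.+1%:R) <= excess t j.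
    rewrite /excess ler_pdivlMr //; apply: le_trans (slope_ge _ _ j2 jt).
    rewrite ler_piMr // ?mulr_ge0 ?(ltW u0) ?subr_ge0 //.
    by rewrite /a_ gerBl ltW // f_gt0.
  have h2 : Num.sqrt (2 * excess t j) <= 2 * eta.
    rewrite -[leRHS]ger0_norm ?mulr_ge0 ?(ltW eta0) // -sqrtr_sqr.
    rewrite ler_sqrt ?sqr_ge0 // exprMn.
    suff : excess t j <= 2 * eta ^+ 2 by lra.
    rewrite /excess ler_pdivrMr //.
    apply: (@le_trans _ _ (2 * eta ^+ 2 * a1)).
      by have := ht2 _ sj; have := f_gt0 _ tln2; lra.
    by rewrite ler_pM2l // mulr_gt0 // exprn_gt0.
  have h3 : s2u * Num.sqrt (t - ln j.+1%:R) <= Num.sqrt (2 * excess t j).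
    have u2 : 0 <= 2 * u by rewrite mulr_ge0 // ltW.
    have ex2 : 0 <= 2 * excess t j by rewrite pmulr_rge0.
    by rewrite /s2u -sqrtrM // ler_sqrt // -mulrA ler_pM2l.
  rewrite -mulrA mulrC; apply: ler_pM => //.
    by rewrite mulr_ge0 ?sqrtr_ge0.
  lra.
apply: (@le_trans _ _ (\sum_(1 <= j < Num.truncn (expR t))
  ((1 - eta) * s2u * (Num.sqrt (ln (expR t / j.+1%:R))
      - Num.sqrt t * (ln j.+1%:R < t2 :> R)%:R)))); last first.
  rewrite /gamma_sum big_nat [leRHS]big_nat; apply: ler_sum => j /andP[j0 jn].
  exact: bound.
rewrite -mulr_sumr -mulrA -[leRHS]mulrA; apply: ler_wpM2l => //.
rewrite big_split /= sumrN -mulr_sumr.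
have hS := hC0 _ (expR_gt0 t); rewrite log_sum_tail ?(ltW t0) // in hS.
set S := \sum_(1 <= j < _) Num.sqrt _ in hS *.
set B := \sum_(1 <= j < _) _.
have hB : B <= expR t2 by apply: count_tail; exact: le_trans t22.
have hsB : Num.sqrt t * B <= Num.sqrt t * expR t2 by exact: ler_wpM2l.
have sqrt_le : 1 <= Num.sqrt t <= t.
  rewrite -{1}sqrtr1 ler_sqrt ?(ltW t0) // tt1 /=.
  rewrite -[leRHS]ger0_norm ?(ltW t0) // -sqrtr_sqr ler_sqrt ?sqr_ge0 //.
  by rewrite expr2 ler_peMl // ltW.
have [sq1 sqt] := andP sqrt_le.
have hM : K * t <= eta * expR t.
  have h1 : t ^+ 2 / 4 <= expR t.
    have -> : expR t = expR (t / 2) ^+ 2 by rewrite expr2 -expRD -splitr.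
    have -> : t ^+ 2 / 4 = (t / 2) ^+ 2 by field.
    apply: lerXn2r; rewrite ?nnegrE ?expR_ge0 ?divr_ge0 ?(ltW t0) //.
    by apply: le_trans (expR_ge1Dx _); rewrite lerDr.
  move: tt3; rewrite ler_pdivrMr // => tt3.
  apply: (@le_trans _ _ (eta * (t ^+ 2 / 4))); last by rewrite ler_pM2l.
  rewrite [leRHS](_ : _ = (t * eta / 4) * t); last by field.
  by rewrite ler_pM2r //; lra.
have hK : C0 + Num.sqrt t * expR t2 + Num.sqrt t <= K * t.
  have e2 := expR_gt0 t2.
  have : C0 <= C0 * t by rewrite ler_peMr.
  have : Num.sqrt t * expR t2 <= expR t2 * t by rewrite mulrC ler_pM2l.
  rewrite /K; lra.
have hmain : expR t * (Num.sqrt pi / 2 - 2 * eta) <= S - Num.sqrt t * B by lra.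
apply: (@le_trans _ _ (s2u * (expR t * (Num.sqrt pi / 2 - 2 * eta)))).
  2: exact: ler_wpM2l.
have su0 : 0 <= Num.sqrt u by exact: sqrtr_ge0.
have e1 : s2u * (expR t * (Num.sqrt pi / 2 - 2 * eta)) =
   expR t * (cst * Num.sqrt u - s2u * (2 * eta)).
  by rewrite -cstE ?(ltW u0) // -/s2u; ring.
have s2le : s2u <= 2 * Num.sqrt u.
  rewrite /s2u sqrtrM // ler_wpM2r //.
  rewrite -[leRHS]ger0_norm // -sqrtr_sqr ler_sqrt ?sqr_ge0 //; lra.
rewrite e1 mulrCA ler_pM2l ?expR_gt0 //.
have : s2u * (2 * eta) <= 2 * Num.sqrt u * (2 * eta).
  by rewrite ler_wpM2r // mulr_ge0 // ltW.
lra.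
Qed.

(** Both g and c n sv lie within the factors 1 - d and 1 + d of c M su. The choice d = 5 h comes
    from (1 - h) (c - 4 h) >= (1 - 5 h) c for c >= 1. *)
Lemma ratio_close (e d h c M n su sv g : R) :
  0 < e -> 0 < d -> d <= e / 4 -> d <= 1 / 4 -> d = 5 * h -> 1 <= c -> 0 < M ->
  (1 - d) * M <= n -> n <= M -> 0 < su -> su <= sv -> sv <= (1 + d) * su ->
  g <= ((1 + h) * c + h) * (M * su) ->
  (1 - h) * (c - 4 * h) * (M * su) <= g ->
  0 < c * n * sv /\ `|g / (c * n * sv) - 1| <= e.
Proof.
move=> e0 d0 de d1 hd c1 M0 dM nM su0 squv sqvu gle gge.
have h0 : 0 < h by lra.
have c0 : 0 < c by lra.
have n0 : 0 < n by apply: lt_le_trans dM; rewrite mulr_gt0 //; lra.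
have sv0 : 0 < sv by exact: lt_le_trans squv.
pose G := c * M * su.
pose G' := c * n * sv.
have G0 : 0 < G by rewrite !mulr_gt0.
have G'0 : 0 < G' by rewrite !mulr_gt0.
have G'le : G' <= (1 + d) * G.
  apply: (@le_trans _ _ (c * M * ((1 + d) * su))).
    apply: ler_pM => //; rewrite ?(ltW sv0) ?mulr_ge0 ?(ltW c0) ?(ltW n0) //.
    by rewrite ler_pM2l.
  by rewrite /G mulrCA.
have G'ge : (1 - d) * G <= G'.
  rewrite /G mulrA mulrCA /G' -!mulrA ler_pM2l // mulrA.
  by apply: ler_pM; rewrite ?(ltW su0) // mulr_ge0 ?(ltW M0) //; lra.
have up : g <= (1 + d) * G.
  apply: (le_trans gle).
  rewrite [leRHS](_ : _ = (1 + d) * c * (M * su)); last by rewrite /G; ring.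
  rewrite ler_pM2r ?mulr_gt0 //.
  have : h * 1 <= h * c by rewrite ler_pM2l.
  have : h * c * 2 <= d * c by rewrite mulrAC ler_pM2r //; lra.
  lra.
have lo : (1 - d) * G <= g.
  apply: le_trans gge.
  rewrite [leLHS](_ : _ = (1 - d) * c * (M * su)); last by rewrite /G; ring.
  rewrite ler_pM2r ?mulr_gt0 //.
  have : (1 - h) * (4 * h) <= (4 * h) * c.
    apply: (@le_trans _ _ (4 * h)); first by apply: ler_piMl; lra.
    by apply: ler_peMr => //; lra.
  have hdc : d * c = 5 * (h * c) by rewrite hd; ring.
  move=> hq; lra.
split; first exact: G'0.
rewrite -/G' ler_norml; apply/andP; split.
  rewrite lerBrDr ler_pdivlMr //; apply: le_trans lo.
  have [le1|gt1] := leP e 1; last first.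
    apply: (@le_trans _ _ 0); first by rewrite addrC mulr_le0_ge0 ?(ltW G'0) //; lra.
    by rewrite mulr_ge0 ?(ltW G0) //; lra.
  apply: (@le_trans _ _ ((1 - e) * ((1 + d) * G))).
    by rewrite addrC ler_wpM2l // subr_ge0.
  rewrite mulrA ler_pM2r //; have : 0 <= e * d by rewrite mulr_ge0 // ltW.
  lra.
rewrite lerBlDr ler_pdivrMr //; apply: (le_trans up).
apply: (@le_trans _ _ ((1 + e) * ((1 - d) * G))); last first.
  by rewrite [e + 1]addrC ler_pM2l //; lra.
rewrite [leRHS]mulrA ler_pM2r //.
have : e * d <= e * (1 / 4) by rewrite ler_pM2l.
lra.
Qed.

(** It remains to replace exp t by N and f' t by f' (ln N). Since N > exp t - 2, ln N is at least t
    + ln (1 - d), hence at least (1 - eps) t for large t, and [dprofile_regular] compares the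
    derivatives. *)
Lemma gamma_sum_asymp (e : R) : 0 < e -> exists t0, forall t, t0 <= t ->
  let N := (Num.truncn (expR t)).-1 in
  0 < cst * N%:R * Num.sqrt (- f' (ln N%:R)) /\
  `|gamma_sum t / (cst * N%:R * Num.sqrt (- f' (ln N%:R))) - 1| <= e.
Proof.
move=> e0; pose d := Num.min e 1 / 4.
have d0 : 0 < d by rewrite /d divr_gt0 // lt_min e0 /=.
have de : d <= e / 4 by rewrite /d ler_pM2r // ge_min lexx.
have d1 : d <= 1 / 4 by rewrite /d ler_pM2r // ge_min lexx orbT.
pose h := d / 5.
have h0 : 0 < h by rewrite divr_gt0.
have h1 : h < 1 by rewrite /h; lra.
have hd : d = 5 * h by rewrite /h; field.
clearbody h d.
have [t1 ht1] := gamma_sum_le h h0.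
have [t2 ht2] := gamma_sum_ge h h0 h1.
have [eps /andP[e00 e01] [t3 ht3]] := dprofile_regular d d0.
have e01' : 0 < 1 - eps by rewrite subr_gt0.
pose l := - ln (1 - d).
exists (Num.max (Num.max t1 t2) (Num.max (Num.max t3 (Num.max (2 / d) 2))
  (Num.max (l / eps) (ln 2 / (1 - eps))))) => t.
rewrite !ge_max => /andP[/andP[tt1 tt2] /andP[/andP[tt3 /andP[tt4 tt4']] /andP[tt5 tt6]]] N.
have t0 : 0 < t by lra.
set M := expR t.
have M0 : 0 < M by exact: expR_gt0.
have tM : t <= M by apply: le_trans (expR_ge1Dx t); rewrite lerDr.
have trM := truncn_itv (ltW M0).
have tr1 : (0 < Num.truncn M)%N by rewrite truncn_ge_nat ?(ltW M0) //; lra.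
have NE : N%:R + 1 = (Num.truncn M)%:R :> R by rewrite natr1 /N prednK.
clearbody N.
move: trM; rewrite -natr1 -NE => /andP[NM MN].
have dM : (1 - d) * M <= N%:R.
  have : 2 <= d * M.
    by rewrite mulrC -ler_pdivrMr //; apply: le_trans tM.
  lra.
have NM' : N%:R <= M by lra.
have N0 : 0 < N%:R :> R.
  by apply: lt_le_trans dM; rewrite mulr_gt0 //; lra.
have lnN : ln N%:R <= t by rewrite -[t]expRK ler_ln ?posrE.
have lnN' : (1 - eps) * t <= ln N%:R.
  have h2 : t - l <= ln N%:R.
    rewrite /l opprK -[t in leLHS]expRK -lnM ?posrE // ?ler_ln ?posrE //.
    - by rewrite mulrC.
    - by rewrite mulr_gt0 //; lra.
    - lra.
  move: tt5; rewrite ler_pdivrMr // => tt5; lra.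
have s2 : ln 2 <= (1 - eps) * t by move: tt6; rewrite ler_pdivrMr // mulrC.
have lnN2 : ln 2 <= ln N%:R :> R by exact: le_trans s2 lnN'.
set u := - f' t; set v := - f' (ln N%:R).
have v0 : 0 < v by exact: df_gt0.
have u0 : 0 < u by apply: df_gt0; exact: le_trans lnN2 lnN.
have uv : u <= v by exact: df_anti.
have vu : v <= (1 + d) * u.
  by apply: le_trans (ht3 t tt3); exact: df_anti.
apply: (ratio_close e d h cst (expR t) N%:R (Num.sqrt u) (Num.sqrt v)) => //.
- by rewrite sqrtr_gt0.
- by rewrite ler_sqrt // ltW.
- have d10 : 0 <= 1 + d by lra.
  rewrite -[1 + d]ger0_norm // -sqrtr_sqr -sqrtrM ?sqr_ge0 //.
  rewrite ler_sqrt ?mulr_ge0 ?sqr_ge0 ?(ltW u0) //.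
  apply: (le_trans vu); rewrite ler_pM2r // expr2 ler_peMl //; lra.
- exact: ht1.
- exact: ht2.
Qed.

End profile_sum.

(** * The weight near x = 2 *)

Section weight_asymptotics.
Context {R : realType} (f : R -> R).
Local Notation f' := (derive_within (log2_ray R) f).
Local Notation f'' := (derive_within (log2_ray R) f').
Hypothesis f_C2 : C2_on (log2_ray R) f.
Hypothesis f_log2 : f (ln 2) < 1.
Hypothesis f_sign :
  forall t, log2_ray R t -> [/\ 0 < f t, f' t < 0 & 0 < f'' t].
Hypothesis f_lim : f n%:R @[n --> \oo] --> (0 : R).
Hypothesis f'_slow : forall eps : R, 0 < eps ->
  N%:R `^ eps * Num.sqrt (- f' (ln N%:R)) @[N --> \oo] --> +oo.

Let f_gt0 t : ln 2 <= t -> 0 < f t.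
Proof. exact: (profile_gt0 f f_sign). Qed.
Let f_anti s t : ln 2 <= s -> s <= t -> f t <= f s.
Proof. exact: (profile_anti f f_C2 f_sign). Qed.

Let ln2_le_lnS (k : nat) : ln 2 <= ln k.+2%:R :> R.
Proof. by rewrite ler_ln ?posrE ?ltr0n // ler_nat. Qed.

Lemma a_profile_gt0 n : 0 < a_ f n.+1.
Proof. by rewrite subr_gt0; apply: le_lt_trans f_log2; exact: f_anti. Qed.

Lemma a_profile_nd n : a_ f n.+1 <= a_ f n.+2.
Proof.
by rewrite lerD2l lerN2; apply: f_anti => //; rewrite ler_ln ?posrE ?ltr0n // ler_nat.
Qed.

Lemma a_profile_lt1 n : a_ f n.+1 < 1.
Proof. by rewrite gtrBl f_gt0. Qed.

Lemma a_profile_cvg : a_ f n @[n --> \oo] --> (1 : R).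
Proof.
apply/cvgrPdist_le => e e0.
have [t0 t02 ht0] := profile_small f f_C2 f_sign f_lim e e0.
exists (Num.truncn (expR t0)).+1 => // n /= tn.
have h : t0 <= ln n.+1%:R.
  rewrite -ler_expR lnK ?posrE ?ltr0n //; apply/ltW.
  apply: (lt_trans (truncnS_gt (expR t0))); rewrite ltr_nat ltnS.
  exact: leq_trans tn.
rewrite /a_ opprB addrCA subrr addr0 ger0_norm; first exact: ht0.
by apply/ltW/f_gt0; exact: le_trans h.
Qed.

(** By convexity the increment is at least - f' (ln (k+3)) times ln (k+3) - ln (k+2). Each factor is
    at least 1/(k+3), the first by [dprofile_slow] with exponent 1/2 and constant 1. *)
Lemma a_increment : exists n0, forall k, (n0 <= k)%N ->
  k.+3%:R ^- 2 <= a_ f k.+2 - a_ f k.+1.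
Proof.
have half0 : 0 < 1 / 2 :> R by rewrite divr_gt0.
have [t0 ht0] := dprofile_slow f f_C2 f_sign f'_slow (1 / 2) 1 half0.
exists (Num.truncn (expR t0)).+1 => k kn.
have k3 : 0 < k.+3%:R :> R by rewrite ltr0n.
have h : t0 <= ln k.+3%:R.
  rewrite -ler_expR lnK ?posrE //; apply/ltW.
  apply: (lt_trans (truncnS_gt (expR t0))); rewrite ltr_nat.
  by rewrite (leq_ltn_trans kn) // ltnS leqW.
have df : k.+3%:R^-1 <= - f' (ln k.+3%:R).
  have := ht0 _ h; set v := - f' _.
  have e1 : expR (1 / 2 * ln k.+3%:R) ^+ 2 = k.+3%:R :> R.
    by rewrite expr2 -expRD -mulrDl -splitr mul1r lnK ?posrE.
  have v0 : 0 < v.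
    by rewrite oppr_gt0; apply: (dprofile_lt0 f f_sign); exact: ln2_le_lnS.
  move=> h1; have : 1 ^+ 2 <= (expR (1 / 2 * ln k.+3%:R) * Num.sqrt v) ^+ 2.
    by apply: lerXn2r => //; rewrite nnegrE // mulr_ge0 ?expR_ge0 ?sqrtr_ge0.
  rewrite expr1n exprMn e1 sqr_sqrtr ?(ltW v0) // => h2.
  by rewrite -[leLHS]mul1r ler_pdivrMr // mulrC.
have -> : a_ f k.+2 - a_ f k.+1 = f (ln k.+2%:R) - f (ln k.+3%:R).
  by rewrite /a_; ring.
have lnk : ln k.+2%:R <= ln k.+3%:R :> R by rewrite ler_ln ?posrE ?ltr0n // ler_nat.
apply: le_trans (profile_slope_ge f f_C2 f_sign _ _ (ln2_le_lnS _) lnk).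
have dl : k.+3%:R^-1 <= ln k.+3%:R - ln k.+2%:R :> R.
  rewrite -lerN2 opprB -ln_div ?posrE ?ltr0n //.
  have -> : k.+2%:R / k.+3%:R = 1 + - k.+3%:R^-1 :> R.
    have -> : k.+2%:R = k.+3%:R - 1 :> R by rewrite -[k.+3%:R]natr1 addrK.
    by rewrite mulrBl divff ?mul1r // gt_eqF.
  apply: le_ln1Dx; rewrite ltrN2 invf_lt1 // ltr1n //.
by rewrite -exprVn expr2; apply: ler_pM => //; rewrite invr_ge0 ltW.
Qed.

Lemma a_sqr_increment : exists n0, forall k, (n0 <= k)%N ->
  2 * a_ f 1 * k.+3%:R ^- 2 <= a_ f k.+2 ^+ 2 - a_ f k.+1 ^+ 2.
Proof.
have [n0 h0] := a_increment; exists n0 => k /h0 hk.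
have h1 : a_ f 1 <= a_ f k.+1 by exact: (a_homo (a_ f) a_profile_nd 0 k).
have h2 : a_ f 1 <= a_ f k.+2 by exact: (a_homo (a_ f) a_profile_nd 0 k.+1).
rewrite subr_sqr [leLHS]mulrC; apply: ler_pM; last by lra.
- by rewrite invr_ge0 exprn_ge0.
- by rewrite mulr_ge0 // ltW // a_profile_gt0.
- exact: hk.
Qed.

Context (mu : probability (measurableTypeR R) R) (p : nat -> {poly R}).
Hypothesis p0 : p 0%N = 1.
Hypothesis p_rec0 : 'X * p 0%N = a_ f 1%N *: p 1%N.
Hypothesis p_rec : forall n,
  'X * p n.+1 = a_ f n.+2 *: p n.+2 + a_ f n.+1 *: p n.

(** [turan_lower] and [turan_upper] enclose D between multiples of exp (2 g) whose coefficients are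
    powers of N up to constants; after logarithms only O(ln N) is left. *)
Lemma log_turan_lim : exists C t0, forall t, t0 <= t ->
  let N := (Num.truncn (expR t)).-1 in
  let x := 2 * (1 - f t) in
  [/\ ln 2 <= t, 0 < x < 2, 1 <= ln N%:R :> R &
    `|ln (turan_lim p (a_ f) x) - 2 * gamma_sum f t| <= C * ln N%:R].
Proof.
have [n0 hinc] := a_sqr_increment.
pose a1 := a_ f 1; have a10 : 0 < a1 by exact: a_profile_gt0.
pose c1 : R := 2 * (2 / a1) ^+ 2 + 1.
pose c2 : R := 2 / a1.
have c20 : 0 < c2 by rewrite divr_gt0.
have c10 : 0 < c1 by rewrite ltr_wpDl // mulr_ge0 // sqr_ge0.
pose A : R := `|ln c1| + 2 * `|ln (1 + c2)| + 4 * `|ln 2| + `|ln (2 * a1)|.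
(* The 4 collects the exponents of (N + 3)^2 and (1 + N c2)^2. The first threshold puts N - 1 past
   [n0] and makes N >= 3; the second gives N >= e, so that ln N >= 1 absorbs the constants in
   [A]. *)
exists (A + 4), (Num.max (ln n0.+4%:R) (ln (expR 1 + 2))) => t.
rewrite ge_max => /andP[tn te] N x.
have e1 : 0 < expR 1 + 2 :> R by rewrite addr_gt0 ?expR_gt0.
have Mn : n0.+4%:R <= expR t :> R by rewrite -[leLHS]lnK ?posrE ?ltr0n // ler_expR.
have Me : expR 1 + 2 <= expR t by rewrite -[leLHS]lnK ?posrE // ler_expR.
have trM := truncn_itv (expR_ge0 t).
have trn : (n0.+4 <= Num.truncn (expR t))%N by rewrite truncn_ge_nat ?expR_ge0.
have NE : N.+1 = Num.truncn (expR t) by rewrite /N prednK // (leq_trans _ trn).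
have Nn : (n0.+3 <= N)%N by rewrite -ltnS NE.
clearbody N.
rewrite -NE in trM; case/andP: trM => NM MN.
have gsumE : gamma_sum f t = \sum_(1 <= j < N.+1) gamma_ (a_ f) j x.
  by rewrite /gamma_sum NE.
have t2 : ln 2 <= t.
  rewrite -[leRHS]expRK ler_ln ?posrE ?expR_gt0 //.
  by apply: le_trans Me; rewrite lerDr expR_ge0.
have NRe : expR 1 <= N%:R :> R.
  have : expR t < N%:R + 2 by move: MN; rewrite -!natr1; lra.
  lra.
have NR0 : 0 < N%:R :> R by exact: lt_le_trans (expR_gt0 1) NRe.
have lnN1 : 1 <= ln N%:R :> R by rewrite -[leLHS]expRK ler_ln ?posrE ?expR_gt0.
have lnNt : ln N.+1%:R <= t by rewrite -[leRHS]expRK ler_ln ?posrE ?ltr0n ?expR_gt0.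
have tlnN : t <= ln N.+2%:R.
  by rewrite -[leLHS]expRK ler_ln ?posrE ?ltr0n ?expR_gt0 // ltW.
have x02 : 0 < x < 2.
  have h1 : f t <= f (ln 2) by exact: f_anti.
  have h2 := f_gt0 _ t2; move: f_log2 => h3.
  have h4 : f t < 1 by exact: le_lt_trans h1 h3.
  by rewrite /x; apply/andP; split; lra.
have /andP[x0 x2] := x02.
have xabs : `|x| < 2 by rewrite gtr0_norm.
have N0 : (0 < N)%N by exact: leq_trans Nn.
have aN k : (0 < k <= N)%N -> 0 < a_ f k /\ 2 * a_ f k <= x.
  case: k => // k /andP[_ kN]; split; first exact: a_profile_gt0.
  rewrite /x ler_pM2l // lerD2l lerN2; apply: f_anti => //.
  apply: le_trans lnNt; rewrite ler_ln ?posrE ?ltr0n // ler_nat ltnS //.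
have gam0 k : (0 < k <= N)%N -> 0 <= gamma_ (a_ f) k x.
  by move=> /aN[h1 h2]; have [] := gamma_P (a_ f) k x h1 h2.
have gamE k : (0 < k <= N)%N -> x = a_ f k *
    (expR (gamma_ (a_ f) k x) + expR (- gamma_ (a_ f) k x)).
  move=> /aN[h1 h2]; have [_] := gamma_P (a_ f) k x h1 h2.
  rewrite /cosh [2 * _]mulrC divfK // => <-.
  by rewrite mulrC divfK // gt_eqF.
pose pv := fun k : nat => (p k).[x].
have pv0 : pv 0%N = 1 by rewrite /pv p0 hornerE.
have pv1 : x = a_ f 1 * pv 1%N.
  have := congr1 (fun q : {poly R} => q.[x]) p_rec0.
  by rewrite /= hornerM hornerX hornerZ p0 hornerE mulr1.
have pvS n : x * pv n.+1 = a_ f n.+2 * pv n.+2 + a_ f n.+1 * pv n.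
  have := congr1 (fun q : {poly R} => q.[x]) (p_rec n).
  by rewrite /= hornerM hornerX hornerD !hornerZ.
set D := turan_lim p (a_ f) x.
have D0 : 0 < D by apply: turan_lim_gt0 => //;
  [exact: a_profile_gt0|exact: a_profile_nd|exact: a_profile_lt1|exact: a_profile_cvg].
pose E := expR (gamma_sum f t); have E0 : 0 < E by exact: expR_gt0.
have lower : (2 * a1 * N.+2%:R ^- 2) * E ^+ 2 <= D.
  have h1 : (turan_poly p (a_ f) N).[x] <= D.
    by apply: turan_lim_ge => //;
      [exact: a_profile_gt0|exact: a_profile_nd|exact: a_profile_lt1|exact: a_profile_cvg].
  apply: le_trans h1; rewrite turan_polyE.
  have := @turan_lower R (a_ f) x pv a_profile_gt0 a_profile_nd pv0 pv1 pvS N _ gam0 gamE N0.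
  rewrite -gsumE -/E; apply: le_trans; rewrite ler_pM2r ?exprn_gt0 //.
  have := hinc N.-1; rewrite prednK //; apply.
  by rewrite -ltnS prednK // (leq_trans _ Nn) // ltnS !leqW.
(* From t <= ln (N + 2) one gets x/2 <= a_{N+1}, with no quantitative gap; at N + 2 the gap is at
   least a full increment of a^2. *)
pose q := a_ f N.+2 ^+ 2 - x ^+ 2 / 4.
have qge : 2 * a1 * N.+3%:R ^- 2 <= q.
  apply: le_trans (hinc N _) _; first by rewrite (leq_trans _ Nn) // !leqW.
  rewrite lerD2l lerN2.
  have -> : x ^+ 2 / 4 = (1 - f t) ^+ 2 by rewrite /x; field.
  apply: lerXn2r; rewrite ?nnegrE ?(ltW (a_profile_gt0 _)) //.
    by move: x0; rewrite /x; lra.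
  by rewrite lerD2l lerN2; exact: f_anti.
have N3 (k : nat) : 0 < k.+1%:R ^- 2 :> R by rewrite invr_gt0 exprn_gt0.
have q0 : 0 < q by apply: lt_le_trans qge; rewrite !mulr_gt0.
have upper : D * (2 * a1 * N.+3%:R ^- 2) <= c1 * ((1 + N%:R * c2) * E) ^+ 2.
  apply: (@le_trans _ _ (D * q)); first by rewrite ler_pM2l.
  have h1 : D * q <= (turan_poly p (a_ f) N.+1).[x].
    by apply: turan_lim_le => //; [exact: a_profile_gt0|exact: a_profile_nd|exact: a_profile_lt1].
  apply: (le_trans h1); rewrite turan_polyE.
  have := @turan_upper R (a_ f) x pv a_profile_gt0 a_profile_nd a_profile_lt1
    pv0 pv1 pvS N _ gam0 gamE N0 (ltW x2).
  by rewrite -gsumE -/E -/a1 -/c1 /c2 [N%:R * (2 / a1)]mulrA.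
have a20 : 0 < 2 * a1 by rewrite mulr_gt0.
have A0 : 0 <= A by rewrite /A !addr_ge0 // mulr_ge0.
have AE : A = `|ln c1| + 2 * `|ln (1 + c2)| + 4 * `|ln 2| + `|ln (2 * a1)| by [].
clearbody A c1 c2 a1 D q.
have lnE : ln (E ^+ 2) = 2 * gamma_sum f t.
  by rewrite lnXn // /E expRK mulr_natl.
have ln_inv (k : nat) : ln (k.+1%:R ^- 2) = - (2 * ln k.+1%:R) :> R.
  by rewrite lnV ?posrE ?exprn_gt0 // lnXn // mulr_natl.
have lnN3 : ln N.+3%:R <= ln 2 + ln N%:R :> R.
  rewrite -lnM ?posrE // ler_ln ?posrE ?mulr_gt0 ?ltr0n //.
  have N3' : 3%:R <= N%:R :> R by rewrite ler_nat (leq_trans _ Nn).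
  rewrite -!natr1; lra.
have lnN2 : ln N.+2%:R <= ln 2 + ln N%:R :> R.
  by apply: le_trans lnN3; rewrite ler_ln ?posrE ?ltr0n // ler_nat.
have lnNc : ln (1 + N%:R * c2) <= ln N%:R + ln (1 + c2).
  have c21 : 0 < 1 + c2 by rewrite addr_gt0.
  have N1 : 1 <= N%:R :> R by rewrite ler1n.
  rewrite -lnM ?posrE // ler_ln ?posrE ?mulr_gt0 ?addr_gt0 ?mulr_gt0 //.
  by rewrite mulrDr mulr1 lerD2r.
have lo : ln (2 * a1) - 2 * ln N.+2%:R + 2 * gamma_sum f t <= ln D.
  rewrite -lnE -[- _ in leLHS]ln_inv -!lnM ?posrE ?mulr_gt0 ?exprn_gt0 //.
  by rewrite ler_ln ?posrE ?mulr_gt0 ?exprn_gt0.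
have up : ln D + (ln (2 * a1) - 2 * ln N.+3%:R) <=
    ln c1 + (2 * ln (1 + N%:R * c2) + 2 * gamma_sum f t).
  have b0 : 0 < 1 + N%:R * c2 by rewrite addr_gt0 // mulr_gt0.
  rewrite -lnE [2 * ln (1 + _)]mulr_natl -lnXn //.
  rewrite -[- _ in leLHS]ln_inv -!lnM ?posrE ?mulr_gt0 ?exprn_gt0 //.
  by rewrite -exprMn ler_ln ?posrE ?mulr_gt0 ?exprn_gt0 ?mulr_gt0.
split => //; rewrite mulrDl.
have AN : A <= A * ln N%:R by rewrite ler_peMr.
have b1 := ler_norm (ln c1); have b2 := ler_norm (ln (1 + c2)).
have b3 := ler_norm (ln 2 : R); have b4 := ler_norm (ln (2 * a1)).
have b5 : - ln (2 * a1) <= `|ln (2 * a1)| by rewrite -normrN ler_norm.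
have b8 := normr_ge0 (ln 2 : R); have b6 := normr_ge0 (ln c1); have b7 := normr_ge0 (ln (1 + c2)).
rewrite {1}AE in AN; move: (ln D) (gamma_sum f t) lo up => lD g lo up.
rewrite ler_norml; apply/andP; split; lra.
Qed.

End weight_asymptotics.

Theorem mainTheorem5 (R : realType) (f : R -> R)
  (f' := derive_within (log2_ray R) f)
  (f'' := derive_within (log2_ray R) f')
  (f_C2 : C2_on (log2_ray R) f)
  (f_log2 : f (ln 2) < 1)
  (f_sign : forall t, log2_ray R t -> [/\ 0 < f t, f' t < 0 & 0 < f'' t])
  (f_lim : f n%:R @[n --> \oo] --> (0 : R))
  (f'_slow : forall eps : R, 0 < eps ->
     N%:R `^ eps * Num.sqrt (- f' (ln N%:R)) @[N --> \oo] --> +oo)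
  (f'_regular :
     limn_esup (fun k : nat =>
       ((- f' ((1 - eps) * k%:R)) / (- f' k%:R))%:E) @[eps --> (0 : R)^'+]
     --> (1%E : \bar R))
  (mu : probability (measurableTypeR R) R)
  (mu_jacobi : has_jacobi_parameters mu (a_ f) (fun _ => 0)) :
  exists w Q : R -> R,
    [/\ is_density mu w,
        {in `]-2, 2[, continuous w},
        {in `]-2, 2[, forall x, w x = expR (- (2 * Q x))},
        exists r : R -> R,
          r x @[x --> (2 : R)^'-] --> (0 : R) /\
          \forall x \near (2 : R)^'-,
            g_ f x = Num.sqrt (pi / 2) * (N_ f x)%:R *
                     Num.sqrt (- f' (ln (N_ f x)%:R)) * (1 + r x)
      & exists h1 h2 : R -> R,
          [/\ h1 =O_ ((2 : R)^'-) (fun x => ln (N_ f x)%:R),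
              h2 =O_ ((2 : R)^'-) (fun x => `|ln (1 - x / 2)|)
            & \forall x \near (2 : R)^'-, `|Q x - g_ f x| <= h1 x + h2 x]].
Proof.
have [mu_supp [p [[_ _ p_orth] p0 p_jac]]] := mu_jacobi.
have p_rec0 : 'X * p 0%N = a_ f 1%N *: p 1%N.
  by rewrite p_jac scale0r !addr0.
have p_rec n : 'X * p n.+1 = a_ f n.+2 *: p n.+2 + a_ f n.+1 *: p n.
  by rewrite p_jac scale0r addr0.
have a0 := a_profile_gt0 f f_C2 f_log2 f_sign.
have a_up := a_profile_nd f f_C2 f_sign.
have a1 := a_profile_lt1 f f_sign.
have a_to1 := a_profile_cvg f f_C2 f_sign f_lim.
pose D := turan_lim p (a_ f).
have D_gt0 x : `|x| < 2 -> 0 < D x by exact: turan_lim_gt0.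
pose w := jacobi_weight p (a_ f).
have wE x : w x = semicircle x / D x by exact: jacobi_weightE.
have semi_gt0 (x : R) : `|x| < 2 -> 0 < 4 - x ^+ 2.
  by rewrite ltr_norml => /andP[? ?]; nra.
have w_gt0 x : `|x| < 2 -> 0 < w x.
  move=> x2; rewrite wE divr_gt0 ?D_gt0 // divr_gt0 ?mulr_gt0 ?pi_gt0 //.
  by rewrite sqrtr_gt0 semi_gt0.
have in_norm (x : R) : x \in `]-2, 2[ -> `|x| < 2 by rewrite in_itv /= ltr_norml.
have gE (x t : R) : 0 <= t -> f t = 1 - x / 2 -> t = pinv (log2_ray R) f (1 - x / 2) ->
    g_ f x = gamma_sum f t.
  move=> t0 ft tE; rewrite /g_ /gamma_sum /N_ -tE prednK; last first.
    by rewrite truncn_ge_nat ?expR_ge0 // expR_ge1.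
  by apply: eq_bigr => j _; congr gamma_; rewrite ft; field.
have ln2_ge0 : 0 <= ln 2 :> R by rewrite ln_ge0 // ler1n.
exists w, (fun x => - ln (w x) / 2); split.
- exact: jacobi_weight_density.
- by move=> x /in_norm x2; exact: jacobi_weight_continuous.
- move=> x /in_norm x2; rewrite mulrC divfK // opprK lnK // posrE; exact: w_gt0.
- pose G (x : R) := Num.sqrt (pi / 2) * (N_ f x)%:R * Num.sqrt (- f' (ln (N_ f x)%:R)).
  exists (fun x => g_ f x / G x - 1); split.
    apply/cvgrPdist_le => e e0; apply: (near2_profile f f_C2 f_log2 f_sign f_lim).
    have [t0 ht0] := gamma_sum_asymp f f_C2 f_log2 f_sign f_lim f'_slow f'_regular e e0.
    exists t0 => x x0 x2 t t2 ft tt0; rewrite sub0r normrN.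
    rewrite (gE x t) //; last exact: le_trans t2.
    by have [_] := ht0 t tt0.
  apply: (near2_profile f f_C2 f_log2 f_sign f_lim).
  (* The tolerance 1 is arbitrary: only the positivity of [G x] is taken from here, to cancel it in
     g / G. *)
  have [t0 ht0] := gamma_sum_asymp f f_C2 f_log2 f_sign f_lim f'_slow f'_regular 1 ltr01.
  exists t0 => x x0 x2 t t2 ft tt0.
  have [G0 _] := ht0 t tt0.
  by rewrite addrC subrK mulrC divfK // gt_eqF.
have [C [t0 hC]] := log_turan_lim f f_C2 f_log2 f_sign f_lim f'_slow p p0 p_rec0 p_rec.
(* The bound ln 8 is for 4 + 2 x in the factorisation of 4 - x^2, and 2 pi is the normalisation of
   the semicircle density; ln N >= 1 puts both constants into the first error term. *)
pose K := `|C| + ln 8 + `|ln (2 * pi)|.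
have ln8 : 0 <= ln 8 :> R by rewrite ln_ge0 // ler1n.
exists (fun x => K * ln (N_ f x)%:R), (fun x => `|ln (1 - x / 2)|); split.
- apply/eqO_exP; exists (`|K| + 1); first by rewrite ltr_wpDl.
  apply: nearW => x; rewrite normrM ler_wpM2r // lerDl //.
- apply/eqO_exP; exists 1 => //.
  by apply: nearW => x; rewrite normr_id mul1r.
apply: (near2_profile f f_C2 f_log2 f_sign f_lim).
exists t0 => x x0 x2 t t2 ft tt0.
rewrite (gE x t) //; last exact: le_trans t2.
have [_ _ lnN1] := hC t tt0.
have -> : 2 * (1 - f t) = x by rewrite ft; field.
have -> : N_ f x = (Num.truncn (expR t)).-1 by [].
rewrite -/(D x); set n := ln _ in lnN1 *.
have xabs : `|x| < 2 by rewrite gtr0_norm.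
have D0 := D_gt0 x xabs; have s0 := semi_gt0 x xabs.
have pi0 : 0 < 2 * pi :> R by rewrite mulr_gt0 // pi_gt0.
have lnw : ln (w x) = ln (Num.sqrt (4 - x ^+ 2)) - ln (2 * pi) - ln (D x).
  by rewrite wE /semicircle !ln_div ?posrE ?divr_gt0 ?sqrtr_gt0.
have lnsq : 2 * ln (Num.sqrt (4 - x ^+ 2)) = ln (4 - x ^+ 2).
  by rewrite mulr_natl -lnXn ?sqrtr_gt0 // sqr_sqrtr // ltW.
have ln4 : ln (4 - x ^+ 2) = ln (1 - x / 2) + ln (4 + 2 * x).
  rewrite -lnM ?posrE; [by congr ln; field|lra|lra].
have ln4_ge0 : 0 <= ln (4 + 2 * x) by apply: ln_ge0; lra.
have ln4_le : ln (4 + 2 * x) <= ln 8 by rewrite ler_ln ?posrE //; lra.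
have Kn : (ln 8 + `|ln (2 * pi)|) * 1 <= (ln 8 + `|ln (2 * pi)|) * n.
  by rewrite ler_wpM2l // addr_ge0.
have Cn : C * n <= `|C| * n.
  by rewrite ler_wpM2r ?ler_norm // (le_trans _ lnN1).
have Cn0 : 0 <= `|C| * n by rewrite mulr_ge0 // (le_trans _ lnN1).
rewrite lnw /K.
have b1 := ler_norm (ln (2 * pi) : R); have b2 : - ln (2 * pi) <= `|ln (2 * pi)| :> R.
  by rewrite -normrN ler_norm.
have b3 := ler_norm (ln (1 - x / 2)); have b4 : - ln (1 - x / 2) <= `|ln (1 - x / 2)|.
  by rewrite -normrN ler_norm.
rewrite ler_norml => /andP[c1 c2].
rewrite ler_norml; apply/andP; split; lra.
Qed.
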